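(* Let $\lambda=(\lambda_1\ge\cdots\ge\lambda_N\ge0)$ be a signature of size $N$ with nonnegative coordinates. Then for every $x\in\mathbb C\setminus\{0,1,-1\}$, $$\mathfrak X_\lambda(x;N,1)=\frac{2(2N-1)!}{(x-x^{-1})(x+x^{-1}-2)^{N-1}}\cdot\frac1{2\pi\mathbf{i}}\oint_C\frac{x^z-x^{-z}}{\prod_{i=1}^N\bigl(z-(\lambda_i+N-i+1)\bigr)\bigl(z+\lambda_i+N-i+1\bigr)}\,dz,$$ where the (positively oriented) contour $C$ includes only the poles at $\lambda_i+N-i+1$ for $i=1,\dots,N$.
   Context: Symplectic characters: for integers $\lambda_1\ge\cdots\ge\lambda_N\ge0$, $$\chi_\lambda(x_1,\dots,x_N)=\frac{\det\bigl[x_i^{\lambda_j+N+1-j}-x_i^{-(\lambda_j+N+1-j)}\bigr]_{i,j=1}^N}{\det\bigl[x_i^{N+1-j}-x_i^{-N-1+j}\bigr]_{i,j=1}^N}$$ (a Laurent polynomial, evaluated at coinciding arguments as such), and $\mathfrak X_\lambda(x;N,1)=\chi_\lambda(x,1^{N-1})/\chi_\lambda(1^N)$, where $1^m$ stands for $m$ arguments equal to $1$. Powers $x^{\pm z}$ use a fixed choice of $\ln x$; $\mathbf{i}=\sqrt{-1}$. *)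

(* Defs.v *)
From HB Require Import structures.
From mathcomp Require Import all_boot all_order all_algebra.
From mathcomp Require Import complex.
From mathcomp Require Import all_classical all_reals all_analysis.

Set Implicit Arguments.
Unset Strict Implicit.
Unset Printing Implicit Defensive.

Import Order.TTheory GRing.Theory Num.Theory.
Import numFieldNormedType.Exports.

Local Open Scope classical_set_scope.
Local Open Scope complex_scope.
Local Open Scope ring_scope.

(* A Laurent polynomial in N variables, as a finite formal sum of terms
   c * x_1^(e_1) ... x_N^(e_N) with e_i : int; the list is not normalized. *)
Definition laurent (R : realType) (N : nat) : Type :=
  seq (R[i] * {ffun 'I_N -> int}).

Definition laurent_eval (R : realType) (N : nat) (p : laurent R N)
    (x : 'I_N -> R[i]) : R[i] :=
  \sum_(t <- p) t.1 * \prod_(i < N) x i ^ t.2 i.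

(* With j counted from 0, the exponent lambda_j + N + 1 - j (j counted from 1)
   reads lam j + (N - j). *)
Definition shifted (N : nat) (lam : 'I_N -> nat) (j : 'I_N) : nat :=
  (lam j + (N - j))%N.

Definition sympl_det (R : realType) (N : nat) (lam : 'I_N -> nat)
    (x : 'I_N -> R[i]) : R[i] :=
  \det (\matrix_(i < N, j < N)
          (x i ^+ shifted lam j - x i ^- shifted lam j)).

Definition represents_sympl_char (R : realType) (N : nat) (lam : 'I_N -> nat)
    (p : laurent R N) : Prop :=
  forall x : 'I_N -> R[i], (forall i, x i != 0) ->
    sympl_det (fun=> 0%N) x != 0 ->
    laurent_eval p x = sympl_det lam x / sympl_det (fun=> 0%N) x.

(* The quotient of determinants is a Laurent polynomial, which is then evaluated
   everywhere on the torus, including where the denominator vanishes.  The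
   default [::] of xget plays no role since such a Laurent polynomial exists,
   and its values at points with nonzero coordinates do not depend on the
   representing list. *)
Definition sympl_char (R : realType) (N : nat) (lam : 'I_N -> nat)
    (x : 'I_N -> R[i]) : R[i] :=
  laurent_eval
    (xget [::] [set p : laurent R N | represents_sympl_char lam p]) x.

Definition normalized_sympl_char (R : realType) (N : nat) (lam : 'I_N -> nat)
    (x : R[i]) : R[i] :=
  sympl_char lam (fun i : 'I_N => if val i == 0%N then x else 1)
  / sympl_char lam (fun=> 1 : R[i]).

Definition cexp (R : realType) (z : R[i]) : R[i] :=
  (expR (complex.Re z) * cos (complex.Im z))
  +i* (expR (complex.Re z) * sin (complex.Im z)).

Definition re_path (R : realType) (gam : R -> R[i]) : R -> R :=
  fun t => complex.Re (gam t).
Definition im_path (R : realType) (gam : R -> R[i]) : R -> R :=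
  fun t => complex.Im (gam t).

(* One-sided derivatives at the endpoints are encoded by a derivative on
   ]a, b[ extending continuously to [a, b]. *)
Definition C1_on (R : realType) (a b : R) (f : R -> R) : Prop :=
  {within `[a, b], continuous f} /\
  exists g : R -> R, {within `[a, b], continuous g} /\
    forall t, t \in `]a, b[ -> is_derive t 1 f (g t).

Definition piecewise_C1 (R : realType) (a b : R) (gam : R -> R[i]) : Prop :=
  exists s : seq R, [/\ path <%R a s, last a s = b &
    forall k, (k < size s)%N ->
      C1_on (nth a (a :: s) k) (nth a s k) (re_path gam) /\
      C1_on (nth a (a :: s) k) (nth a s k) (im_path gam)].

Definition closed_contour (R : realType) (a b : R) (gam : R -> R[i]) : Prop :=
  [/\ a < b, gam a = gam b & piecewise_C1 a b gam].

Definition avoids (R : realType) (a b : R) (gam : R -> R[i]) (p : R[i]) : Prop :=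
  forall t, t \in `[a, b] -> gam t != p.

Definition path_velocity (R : realType) (gam : R -> R[i]) (t : R) : R[i] :=
  derive1 (re_path gam) t +i* derive1 (im_path gam) t.

Definition cintegral (R : realType) (a b : R) (h : R -> R[i]) : R[i] :=
  (\int[lebesgue_measure]_(t in `[a, b]) complex.Re (h t))
  +i* (\int[lebesgue_measure]_(t in `[a, b]) complex.Im (h t)).

Definition contour_integral (R : realType) (a b : R) (gam : R -> R[i])
    (f : R[i] -> R[i]) : R[i] :=
  cintegral a b (fun t => f (gam t) * path_velocity gam t).

Definition two_pi_i (R : realType) : R[i] := 0 +i* (2 * pi).

Definition winding_number (R : realType) (a b : R) (gam : R -> R[i])
    (p : R[i]) : R[i] :=
  contour_integral a b gam (fun z => (z - p)^-1) / two_pi_i R.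

(* For a simple closed positively oriented contour these are the points of its
   interior, resp. exterior; contours with self-intersections are allowed. *)
Definition encloses (R : realType) (a b : R) (gam : R -> R[i]) (p : R[i]) : Prop :=
  avoids a b gam p /\ winding_number a b gam p = 1.

Definition excludes (R : realType) (a b : R) (gam : R -> R[i]) (p : R[i]) : Prop :=
  avoids a b gam p /\ winding_number a b gam p = 0.

(* Main.v *)
Require Import Defs.
From mathcomp Require Import all_boot all_order all_algebra.
From mathcomp Require Import perm ring zify.
From mathcomp Require Import complex.
From mathcomp Require Import all_classical all_reals all_analysis measurable_realfun.
Import Order.TTheory GRing.Theory Num.Theory.
Import numFieldNormedType.Exports.

(** The substitution y = x + 1/x turns x^m - x^-m into (x - 1/x) P_m(y), with
P_m monic of degree m - 1, so the character is, up to a sign, the determinant of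
the divided differences of the P_(m_j), m_j = lambda_j + N - j + 1, at the nodes
y_N, ..., y_1; this is a Laurent polynomial in the x_i which can be evaluated
at coinciding arguments.  At the nodes 2, ..., 2, y its rows are the Taylor
coefficients m_j prod_(i <= k) (m_j^2 - i^2) / (2k + 1)! of P_(m_j) at 2, except
for the last one.  The vector of the weights 1 / (m_j prod_(k <> j) (m_j^2 - m_k^2))
is orthogonal to every row but the last one by Lagrange interpolation in the
variable m^2, so the quotient by the value at 2, ..., 2 is the pairing of the
values P_(m_j)(y) with these weights.

The same weights are the coefficients of the partial fraction decomposition of
the integrand, which reduces the residue computation to the identity
oint e^(L z) / (z - p) dz = e^(L p) oint dz / (z - p).  This one holds along any
closed curve avoiding p, because the integral of e^(s L (z - p)) / (z - p) does not
depend on s. *)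

Set Implicit Arguments.
Unset Strict Implicit.
Unset Printing Implicit Defensive.

Local Open Scope classical_set_scope.
Local Open Scope complex_scope.
Local Open Scope ring_scope.

(** * Lagrange interpolation *)

Section Lagrange.
Variables (F : fieldType) (n : nat) (mu : 'I_n -> F).
Hypothesis mu_inj : injective mu.

(** The leading coefficient of the Lagrange basis polynomial that is 1 at [mu j] and 0 at the other
    nodes. *)
Definition lagrange_weight (j : 'I_n) : F := (\prod_(k < n | k != j) (mu j - mu k))^-1.

Lemma lagrange_weight_neq0 j : \prod_(k < n | k != j) (mu j - mu k) != 0.
Proof.
by apply/prodf_neq0 => k kj; rewrite subr_eq0 (inj_eq mu_inj) eq_sym.
Qed.

Lemma size_prod_XsubC_D1 j :
  size (\prod_(k < n | k != j) ('X - (mu k)%:P)) = n.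
Proof.
rewrite -big_filter size_prod_XsubC -sum1_size big_filter sum1_card.
by rewrite (@cardC1 'I_n) card_ord prednK// (leq_ltn_trans _ (ltn_ord j)).
Qed.

(** The difference of the two sides has size at most [n] but vanishes at the [n] distinct nodes. *)
Lemma lagrange_interpolation (q : {poly F}) : (size q <= n)%N ->
  q = \sum_(j < n) (q.[mu j] * lagrange_weight j)
        *: \prod_(k < n | k != j) ('X - (mu k)%:P).
Proof.
move=> sq; apply/eqP; rewrite -subr_eq0; apply/negPn/negP => D0.
have := max_poly_roots D0 (rs := [seq mu j | j <- enum 'I_n]).
rewrite size_map size_enum_ord.
rewrite ltnNge (leq_trans (size_polyD _ _)) => [H|]; last first.
  rewrite geq_max sq size_polyN.
  apply: (leq_trans (size_sum _ _ _)); apply/bigmax_leqP => j _.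
  by rewrite (leq_trans (size_scale_leq _ _))// size_prod_XsubC_D1.
suff: false by []; apply: H.
- apply/allP => _ /mapP[i _ ->]; rewrite rootE hornerD hornerN horner_sum.
  rewrite (bigD1 i)//= [X in - (_ + X)]big1 ?addr0 => [|j ji].
    rewrite hornerZ horner_prod.
    under eq_bigr => k _ do rewrite hornerXsubC.
    by rewrite mulfVK ?subrr// lagrange_weight_neq0.
  rewrite hornerZ horner_prod (bigD1 i) 1?eq_sym//= hornerXsubC subrr.
  by rewrite mul0r mulr0.
- by rewrite map_inj_uniq ?enum_uniq.
Qed.

(** Compare the coefficients of degree [n - 1] in the interpolation formula, whose products are
    monic of that degree. In particular the weights annihilate the values of every polynomial of
    smaller degree. *)
Lemma lagrange_coef (q : {poly F}) : (size q <= n)%N ->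
  \sum_(j < n) q.[mu j] * lagrange_weight j = q`_n.-1.
Proof.
move=> /lagrange_interpolation {2}->; rewrite coef_sum; apply: eq_bigr => j _.
rewrite coefZ; have -> : n.-1 = (size (\prod_(k < n | k != j) ('X - (mu k)%:P))).-1.
  by rewrite size_prod_XsubC_D1.
rewrite -lead_coefE; have /monicP-> : \prod_(k < n | k != j) ('X - (mu k)%:P) \is monic.
  by apply: monic_prod => k _; exact: monicXsubC.
by rewrite mulr1.
Qed.

(** Interpolation of the constant 1, evaluated at [z] and divided by the full product. *)
Lemma lagrange_partial_fractions (z : F) : (0 < n)%N -> (forall j, z != mu j) ->
  (\prod_(j < n) (z - mu j))^-1 = \sum_(j < n) lagrange_weight j / (z - mu j).
Proof.
move=> n0 zmu; have /lagrange_interpolation E : (size (1%R : {poly F}) <= n)%N.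
  by rewrite size_poly1.
have P0 : \prod_(j < n) (z - mu j) != 0.
  by apply/prodf_neq0 => j _; rewrite subr_eq0.
apply: (mulfI P0); rewrite divff// mulr_sumr.
transitivity (1%:P.[z]); first by rewrite hornerC.
rewrite {1}polyC1 {1}E horner_sum; apply: eq_bigr => j _.
rewrite hornerZ horner_prod hornerC mul1r [in RHS](bigD1 j)//=.
under eq_bigr => k _ do rewrite hornerXsubC.
by field; rewrite subr_eq0.
Qed.

End Lagrange.

(** * Divided differences *)

Section Newton.
Variable F : fieldType.
Implicit Types (z : nat -> F) (f : {poly F}).

(** The value of this iterated quotient at [z k] is the divided difference of [f] at [z 0], ...,
    [z k]. Defined by polynomial division, it makes sense at coinciding nodes. *)
Fixpoint newton_quo z f k : {poly F} :=
  if k is k'.+1 then newton_quo z f k' %/ ('X - (z k')%:P) else f.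

Definition newton_coef z f k : F := (newton_quo z f k).[z k].

Lemma newton_quoS z f k : newton_quo z f k =
  newton_quo z f k.+1 * ('X - (z k)%:P) + (newton_coef z f k)%:P.
Proof. by rewrite {1}(divp_eq (newton_quo z f k) ('X - (z k)%:P)) modp_XsubC. Qed.

Lemma newton_expansion z f n :
  f = \sum_(k < n) newton_coef z f k *: \prod_(l < k) ('X - (z l)%:P)
      + newton_quo z f n * \prod_(l < n) ('X - (z l)%:P).
Proof.
elim: n => [|n IHn]; first by rewrite !big_ord0 add0r mulr1.
rewrite {1}IHn big_ord_recr -addrA; congr (_ + _).
rewrite {1}newton_quoS [in RHS]big_ord_recr/= -mul_polyC.
move: (_ %/ _) => q; ring.
Qed.

(** The remainder of Newton's expansion has the factor [X - z i], so it vanishes at [z i]. *)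
Lemma newton_horner z f (n : nat) i : (i < n)%N ->
  f.[z i] = \sum_(k < n) newton_coef z f k * \prod_(l < k) (z i - z l).
Proof.
move=> ilt; rewrite {1}(newton_expansion z f n) hornerD hornerM.
rewrite [X in _ + _ * X]horner_prod [X in _ + _ * X](bigD1 (Ordinal ilt))//= hornerXsubC subrr.
rewrite mul0r mulr0 addr0 horner_sum; apply: eq_bigr => k _.
by rewrite hornerZ horner_prod; under eq_bigr do rewrite hornerXsubC.
Qed.

(** Newton's expansion factors the matrix of values into the lower triangular matrix of the Newton
    basis at the nodes and the matrix of divided differences; the first factor contributes the
    Vandermonde product. *)
Lemma det_newton z (n : nat) (f : 'I_n -> {poly F}) :
  \det (\matrix_(i < n, j < n) (f j).[z i]) =
  (\prod_(i < n) \prod_(l < i) (z i - z l))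
  * \det (\matrix_(i < n, j < n) newton_coef z (f j) i).
Proof.
pose L := \matrix_(i < n, k < n) \prod_(l < k) (z i - z l).
have -> : \prod_(i < n) \prod_(l < i) (z i - z l) = \det L.
  rewrite det_trig; first by apply: eq_bigr => i _; rewrite mxE.
  apply/is_trig_mxP => i j ij.
  by rewrite mxE (bigD1 (Ordinal ij))//= subrr mul0r.
rewrite -det_mulmx; congr (\det _); apply/matrixP => i j.
rewrite !mxE (newton_horner _ _ (ltn_ord i)).
by apply: eq_bigr => k _; rewrite !mxE mulrC.
Qed.

Lemma eq_newton_quo z z' f k : (forall l, (l < k)%N -> z l = z' l) ->
  newton_quo z f k = newton_quo z' f k.
Proof.
elim: k => //= k IHk zz'; rewrite (zz' k)// IHk// => l lk.
by apply: zz'; rewrite (ltn_trans lk).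
Qed.

(** With all nodes equal to [c], Newton's expansion is the Taylor expansion at [c]. *)
Lemma newton_coef_cst (c : F) f k :
  newton_coef (fun=> c) f k = (f \Po ('X + c%:P))`_k.
Proof.
rewrite [in RHS](newton_expansion (fun=> c) f k.+1).
have E m : (\prod_(l < m) ('X - c%:P)) \Po ('X + c%:P) = 'X^m :> {poly F}.
  by rewrite prodr_const card_ord rmorphXn/= rmorphB/= comp_polyX comp_polyC addrK.
rewrite comp_polyD coefD comp_polyM E coefMXn ltnSn addr0.
rewrite raddf_sum coef_sum big_ord_recr/= big1 => [|i _].
  by rewrite add0r comp_polyZ E coefZ coefXn eqxx mulr1.
by rewrite comp_polyZ E coefZ coefXn gtn_eqF// mulr0.
Qed.

Lemma size_newton_quo z f k : size (newton_quo z f k) = (size f - k)%N.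
Proof.
elim: k => [|k IHk]/=; first by rewrite subn0.
by rewrite size_divp ?polyXsubC_eq0// size_XsubC IHk subnS subn1.
Qed.

Lemma newton_coef_eq0 z f k : (size f <= k)%N -> newton_coef z f k = 0.
Proof.
rewrite -subn_eq0 -(size_newton_quo z) size_poly_eq0 => /eqP f0.
by rewrite /newton_coef f0 horner0.
Qed.

Lemma lead_coef_newton_quo z f k : (k < size f)%N ->
  lead_coef (newton_quo z f k) = lead_coef f.
Proof.
elim: k => //= k IHk kf; rewrite -IHk ?(ltnW kf)//.
rewrite [in RHS]newton_quoS lead_coefDl.
  by rewrite lead_coef_Mmonic ?monicXsubC.
rewrite size_Mmonic ?monicXsubC//.
  rewrite size_XsubC addn2 size_newton_quo.
  by rewrite (leq_ltn_trans (size_polyC_leq1 _))// ltnS subn_gt0.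
by rewrite -size_poly_gt0 size_newton_quo subn_gt0.
Qed.

(** Division by monic factors keeps the leading coefficient, and after [k] of them only a constant
    is left. *)
Lemma newton_coef_lead z f k : size f = k.+1 -> newton_coef z f k = lead_coef f.
Proof.
move=> fk; rewrite -(@lead_coef_newton_quo z f k) ?fk//.
have : (size (newton_quo z f k) <= 1)%N by rewrite size_newton_quo fk subSnn.
by rewrite /newton_coef => /size1_polyC ->; rewrite hornerC lead_coefC.
Qed.

End Newton.

(** * Chebyshev polynomials in x + 1/x and their Taylor coefficients at 2 *)

Section SymplecticPoly.
Variable F : fieldType.

(* The Chebyshev polynomials of the second kind in the variable [x + x^-1]. *)
Fixpoint sympl_poly (m : nat) : {poly F} :=
  if m is m1.+1 then
    if m1 is m2.+1 then 'X * sympl_poly m1 - sympl_poly m2 else 1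
  else 0.

Lemma sympl_polySS m :
  sympl_poly m.+2 = 'X * sympl_poly m.+1 - sympl_poly m.
Proof. by []. Qed.

Lemma sympl_poly_ind (P : nat -> Prop) :
  P 0 -> P 1 -> (forall m, P m -> P m.+1 -> P m.+2) -> forall m, P m.
Proof.
move=> P0 P1 PS m; suff: P m /\ P m.+1 by case.
by elim: m => // m [? ?]; split=> //; apply: PS.
Qed.

(** Both sides satisfy the same recurrence: multiplying x^(m+1) - x^-(m+1) by x + 1/x gives the sum
    of its two neighbours. *)
Lemma sympl_polyE (x : F) m : x != 0 ->
  (x - x^-1) * (sympl_poly m).[x + x^-1] = x ^+ m - x ^- m.
Proof.
move=> x0; elim/sympl_poly_ind: m => [||m IH0 IH1].
- by rewrite horner0 mulr0 expr0 invr1 subrr.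
- by rewrite hornerC mulr1 expr1.
rewrite sympl_polySS hornerD hornerN hornerM hornerX mulrBr mulrCA IH0 IH1.
by rewrite !exprS; field; rewrite x0 expf_neq0.
Qed.

(** The leading coefficient is taken one index higher because [sympl_poly 0] is zero. *)
Lemma sympl_poly_size_lead m :
  (size (sympl_poly m) = m) /\ lead_coef (sympl_poly m.+1) = 1.
Proof.
elim/sympl_poly_ind: m => [||m [s0 l0] [s1 l1]].
- by rewrite size_poly0 lead_coef1.
- by rewrite size_poly1 sympl_polySS subr0 mulr1 lead_coefX.
have X1 : size ('X * sympl_poly m.+1) = m.+2.
  by rewrite mulrC size_mulX ?s1// -size_poly_gt0 s1.
have s2 : size (sympl_poly m.+2) = m.+2.
  by rewrite sympl_polySS size_polyDl ?size_polyN ?s0 X1.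
split=> //; rewrite sympl_polySS lead_coefDl ?size_polyN ?s1.
  by rewrite mulrC lead_coefMX.
by rewrite mulrC size_mulX ?s2// -size_poly_gt0 s2.
Qed.

(** After the substitution the recurrence has the factor X + 2, and the resulting recurrence between
    coefficients is Pascal's rule applied twice. *)
Lemma sympl_poly_shift m k : (sympl_poly m \Po ('X + 2%:P))`_k = 'C(m + k, k.*2.+1)%:R.
Proof.
elim/sympl_poly_ind: m k => [||m IH0 IH1] k.
- rewrite comp_poly0 coef0 bin_small//; lia.
- rewrite comp_polyC coefC; case: k => [|k]; first by rewrite bin1.
  by rewrite bin_small//; lia.
rewrite sympl_polySS comp_polyB comp_polyM comp_polyX mulrDl coefB coefD.
rewrite coefXM coefCM IH0 !IH1.
case: k => [|k] /=.
  by rewrite !addn0 !bin1 add0r -natrM; rewrite -[LHS]addrC; ring.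
rewrite !addSn !addnS doubleS !binS !natrD; ring.
Qed.

(** The falling factorial is (m + k) ... (m - k), symmetric about m; the factors m + i and m - i are
    paired. *)
Lemma ffact_sym m k :
  ((m + k) ^_ k.*2.+1)%:R = m%:R * \prod_(i < k) (m%:R ^+ 2 - i.+1%:R ^+ 2) :> F.
Proof.
elim: k => [|k IHk]; first by rewrite addn0 ffactn1 big_ord0 mulr1.
rewrite big_ord_recr/= mulrA -IHk doubleS addnS ffactSS ffactnSr.
(* If m <= k the falling factorial of length 2k + 1 already vanishes, so both sides are 0. Otherwise
   the subtraction below is not truncated. *)
case: (leqP m k) => mk.
  by rewrite ffact_small ?mul0r ?muln0 ?mul0n ?muln0//; lia.
have -> : (m + k - k.*2.+1 = m - k.+1)%N by lia.
move: ((m + k) ^_ k.*2.+1) => p.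
rewrite natrM natrM natrB// -!addnS natrD; ring.
Qed.

End SymplecticPoly.

(** * Symplectic determinants *)

(** Multiplying [A *m c] by the adjugate shows that the cofactors of the last row of [A] are
    [\det A] times the entries of [c]. The matrix [B] has the same cofactors along its last row. *)
Lemma det_replace_last_row (F : comPzRingType) n (A B : 'M[F]_n.+1) (c : 'cV[F]_n.+1) :
    (forall i j, i != ord_max -> B i j = A i j) ->
    A *m c = delta_mx ord_max 0 ->
  \det B = \det A * \sum_j B ord_max j * c j 0.
Proof.
move=> BA Ac; rewrite (expand_det_row B ord_max) mulr_sumr.
apply: eq_bigr => j _; rewrite [RHS]mulrCA; congr (_ * _).
have -> : cofactor B ord_max j = cofactor A ord_max j.
  rewrite /cofactor; congr (_ * \det _); apply/matrixP => i k.
  by rewrite !mxE BA// eq_sym neq_lift.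
have := congr1 (mulmx (\adj A)) Ac.
rewrite mulmxA mul_adj_mx mul_scalar_mx => /matrixP/(_ j 0).
rewrite !mxE (bigD1 ord_max)//= big1 ?addr0 => [|k kmax]; rewrite !mxE ?eqxx.
  by rewrite mulr1 => <-.
by rewrite (negbTE kmax) mulr0.
Qed.

Section SymplecticDets.
Variables (F : numFieldType) (n : nat) (m : 'I_n.+1 -> nat).
Hypotheses (m_inj : injective m) (m_gt0 : forall j, (0 < m j)%N).

Definition newton_det (z : nat -> F) : F :=
  \det (\matrix_(i < n.+1, j < n.+1) newton_coef z (sympl_poly F (m j)) i).

Let mu (j : 'I_n.+1) : F := (m j)%:R ^+ 2.

Let mu_inj : injective mu.
Proof.
move=> i j /eqP; rewrite /mu eqrXn2 ?ler0n// eqr_nat => /eqP; exact: m_inj.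
Qed.

Let m0 j : (m j)%:R != 0 :> F.
Proof. by rewrite pnatr_eq0 -lt0n. Qed.

Let fact0 k : (k`!)%:R != 0 :> F.
Proof. by rewrite pnatr_eq0 -lt0n fact_gt0. Qed.

(** Up to the factor m / (2k + 1)!, the k-th Taylor coefficient of [sympl_poly m] at 2 is the value
    of [Q k] at m^2. *)
Let Q (k : nat) : {poly F} := \prod_(i < k) ('X - (i.+1%:R ^+ 2)%:P).

Let sizeQ k : size (Q k) = k.+1.
Proof. by rewrite size_prod_XsubC /index_enum -enumT size_enum_ord. Qed.

Let leadQ k : lead_coef (Q k) = 1.
Proof. by apply/monicP; apply: monic_prod => i _; exact: monicXsubC. Qed.

Let newton_coef2 j k : newton_coef (fun=> 2) (sympl_poly F (m j)) k =
  (m j)%:R * (Q k).[mu j] / (k.*2.+1`!)%:R.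
Proof.
rewrite newton_coef_cst sympl_poly_shift; apply: (canRL (mulfK (fact0 _))).
rewrite -natrM bin_ffact ffact_sym; congr (_ * _).
by rewrite horner_prod; apply: eq_bigr => i _; rewrite hornerXsubC.
Qed.

(** Scaling rows and columns leaves the values of the monic polynomials [Q i], of degree i, at the
    distinct points [mu j]; their determinant is the Vandermonde product. *)
Lemma newton_det2_neq0 : newton_det (fun=> 2) != 0.
Proof.
rewrite /newton_det.
pose M := \matrix_(j < n.+1, i < n.+1) (Q i).[mu j].
have -> : \matrix_(i < n.+1, j < n.+1) newton_coef (fun=> 2) (sympl_poly F (m j)) i
   = diag_mx (\row_i ((i : nat).*2.+1`!)%:R^-1) *m M^T *m diag_mx (\row_j (m j)%:R).
  apply/matrixP => i j; rewrite mul_mx_diag mul_diag_mx !mxE newton_coef2; ring.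
rewrite !det_mulmx !det_diag !mulf_neq0//.
- by apply/prodf_neq0 => i _; rewrite mxE invr_neq0.
- have -> : M = \matrix_(j < n.+1, i < n.+1) (Q i).[(fun k => mu (inord k)) j].
    by apply/matrixP => i j; rewrite !mxE inord_val.
  rewrite det_tr (det_newton (fun k => mu (inord k)) (fun i : 'I_n.+1 => Q i)) mulf_neq0//.
    apply/prodf_neq0 => i _; apply/prodf_neq0 => l _.
    rewrite subr_eq0 (inj_eq mu_inj) inord_val.
    apply/eqP => /(congr1 val); rewrite /= inordK; have := ltn_ord l; have := ltn_ord i; lia.
  (* The divided differences of [Q i] vanish beyond order i, and the one of order i is the leading
     coefficient 1. *)
  rewrite -det_tr det_trig => [|].
    apply/prodf_neq0 => i _; rewrite !mxE newton_coef_lead ?sizeQ//.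
    by rewrite leadQ oner_eq0.
  by apply/is_trig_mxP => i j ij; rewrite !mxE newton_coef_eq0// sizeQ.
- by apply/prodf_neq0 => i _; rewrite mxE.
Qed.

(** Moving the last node from 2 to [Y] changes only the last row of the matrix, so the ratio is the
    pairing of the new row with the solution [c] of [A *m c = delta_mx ord_max 0]. *)
Lemma newton_det_ratio (Y : F) : Y != 2 ->
  newton_det (fun k => if (k < n)%N then 2 else Y) / newton_det (fun=> 2) =
  (n.*2.+1`!)%:R / (Y - 2) ^+ n *
  \sum_j (sympl_poly F (m j)).[Y] / (m j)%:R * lagrange_weight mu j.
Proof.
move=> Y2; set z := fun k => _.
pose c : 'cV[F]_n.+1 :=
  \col_j ((n.*2.+1`!)%:R / (m j)%:R * lagrange_weight mu j).
pose A := \matrix_(i < n.+1, j < n.+1) newton_coef (fun=> 2) (sympl_poly F (m j)) i.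
have zlt k f : (k < n)%N -> newton_coef z f k = newton_coef (fun=> 2) f k.
  move=> kn; rewrite /newton_coef /z kn; congr (_.[_]); apply: eq_newton_quo => l lk.
  by rewrite (ltn_trans lk).
have Ac i : (i <= n)%N ->
    \sum_j newton_coef (fun=> 2) (sympl_poly F (m j)) i * c j 0 = (i == n)%:R.
  (* The sum over the n + 1 nodes extracts the coefficient of degree n of [Q i], which is 0 for i <
     n and 1 for i = n; the factor (2n + 1)! in [c] normalizes the last entry. *)
  move=> ilen; transitivity ((n.*2.+1`!)%:R / (i.*2.+1`!)%:R * (Q i)`_n).
    rewrite -(lagrange_coef mu_inj) ?sizeQ// mulr_sumr; apply: eq_bigr => j _.
    by rewrite newton_coef2 mxE; field; rewrite fact0 m0.
  case: eqVneq ilen => [-> _|ni ilen].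
    have -> : (Q n)`_n = lead_coef (Q n) by rewrite lead_coefE sizeQ.
    by rewrite leadQ divff// mulr1.
  by rewrite nth_default ?mulr0// sizeQ ltn_neqAle ni.
have Y20 : (Y - 2) ^+ n != 0 by rewrite expf_neq0// subr_eq0.
(* Newton's expansion at the last node [Y], solved for the last coefficient. The subtracted terms
   are combinations of the earlier rows of [A], hence orthogonal to [c]. *)
have YR j : newton_coef z (sympl_poly F (m j)) n =
    (sympl_poly F (m j)).[Y] / (Y - 2) ^+ n
    - \sum_(k < n) newton_coef (fun=> 2) (sympl_poly F (m j)) k
        * ((Y - 2) ^+ k / (Y - 2) ^+ n).
  have zn : z n = Y by rewrite /z ltnn.
  have E k : (k <= n)%N -> \prod_(l < k) (z n - z l) = (Y - 2) ^+ k.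
    move=> kn; rewrite -[k in RHS]card_ord -prodr_const; apply: eq_bigr => l _.
    by rewrite zn /z (leq_trans (ltn_ord l)).
  apply: (mulIf Y20); rewrite mulrBl divfK//.
  have := newton_horner z (sympl_poly F (m j)) (ltnSn n).
  rewrite [X in _.[X]]zn big_ord_recr/= E// => ->; rewrite addrC mulr_suml.
  rewrite (eq_bigr (fun k : 'I_n => newton_coef (fun=> 2) (sympl_poly F (m j)) k
        * ((Y - 2) ^+ k / (Y - 2) ^+ n) * (Y - 2) ^+ n)) ?addrK// => k _.
  by rewrite zlt// E ?(ltnW (ltn_ord k))// -mulrA divfK.
rewrite /newton_det (@det_replace_last_row _ _ A _ c).
- rewrite mulrAC divff ?newton_det2_neq0// mul1r.
  under eq_bigr => j _ do rewrite mxE YR mulrBl.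
  rewrite sumrB [X in _ - X](_ : _ = 0) ?subr0.
    by rewrite mulr_sumr; apply: eq_bigr => j _; rewrite mxE; field; rewrite m0.
  under eq_bigr => j _ do rewrite mulr_suml.
  rewrite exchange_big big1//= => k _.
  rewrite (eq_bigr (fun j => (Y - 2) ^+ k / (Y - 2) ^+ n *
    (newton_coef (fun=> 2) (sympl_poly F (m j)) k * c j 0))); last by move=> j _; ring.
  by rewrite -mulr_sumr Ac ?(ltnW (ltn_ord k))// ltn_eqF// mulr0.
- move=> i j imax; rewrite !mxE zlt// ltn_neqAle -ltnS ltn_ord andbT.
  by apply: contraNneq imax => E; apply/eqP/val_inj.
- apply/matrixP => i j; rewrite (ord1 j) !mxE.
  under eq_bigr do rewrite mxE.
  by rewrite Ac ?andbT// -ltnS.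
Qed.

End SymplecticDets.

Section SymplecticDeterminant.
Variables (F : numFieldType) (n : nat).

(** The variables are taken in reverse order, so that the variable of index 0, the only one
    different from 1 in the normalized character, becomes the last node. *)
Definition sympl_nodes (x : 'I_n.+1 -> F) (k : nat) : F :=
  x (inord (n - k)) + (x (inord (n - k)))^-1.

Let rev_perm : {perm 'I_n.+1} := perm (@rev_ord_inj n.+1).

(** Each row i has the factor x_i - 1/x_i; what remains is a matrix of polynomial values at the
    nodes, with its rows reversed. *)
Lemma sympl_det_newton (m : 'I_n.+1 -> nat) (x : 'I_n.+1 -> F) : (forall i, x i != 0) ->
  \det (\matrix_(i, j) (x i ^+ m j - x i ^- m j)) =
  (-1) ^+ rev_perm * \prod_i (x i - (x i)^-1)
  * (\prod_(i < n.+1) \prod_(l < i) (sympl_nodes x i - sympl_nodes x l))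
  * newton_det m (sympl_nodes x).
Proof.
move=> x0.
have -> : \matrix_(i, j) (x i ^+ m j - x i ^- m j) =
    diag_mx (\row_i (x i - (x i)^-1)) *m
      row_perm rev_perm (\matrix_(i < n.+1, j < n.+1) (sympl_poly F (m j)).[sympl_nodes x i]).
  apply/matrixP => i j; rewrite mul_diag_mx !mxE permE -sympl_polyE// /sympl_nodes.
  suff -> : inord (n - rev_ord i) = i by [].
  by apply/val_inj; rewrite /= inordK//; have := ltn_ord i; lia.
rewrite row_permE !det_mulmx det_diag det_perm -!mulrA mulrCA; congr (_ * _).
rewrite (det_newton (sympl_nodes x) (fun j => sympl_poly F (m j))); congr (_ * _).
by apply: eq_bigr => i _; rewrite mxE.
Qed.

(** These exponents belong to the zero signature. After reversing the columns, column j comes from a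
    monic polynomial of degree j, so the matrix is unitriangular and only the sign of the reversal
    remains. *)
Lemma newton_det_staircase (z : nat -> F) :
  newton_det (fun j : 'I_n.+1 => (n.+1 - j)%N) z = (-1) ^+ rev_perm.
Proof.
pose U := \matrix_(i < n.+1, j < n.+1) newton_coef z (sympl_poly F j.+1) i.
have -> : newton_det (fun j : 'I_n.+1 => (n.+1 - j)%N) z = \det (col_perm rev_perm U).
  congr (\det _); apply/matrixP => i j; rewrite !mxE permE /=.
  by rewrite subSS subSn// -ltnS.
rewrite col_permE det_mulmx det_perm odd_permV -det_tr det_trig => [|].
  rewrite big1 ?mul1r// => i _; rewrite !mxE newton_coef_lead.
    by have [] := sympl_poly_size_lead F i.
  by have [] := sympl_poly_size_lead F i.+1.
apply/is_trig_mxP => i j ij; rewrite !mxE newton_coef_eq0//.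
by have [-> _] := sympl_poly_size_lead F i.+1.
Qed.

(** The row factors and the Vandermonde product cancel; the sign of the staircase determinant is its
    own inverse. *)
Lemma sympl_det_quotient (m : 'I_n.+1 -> nat) (x : 'I_n.+1 -> F) : (forall i, x i != 0) ->
  let d := \det (\matrix_(i, j) (x i ^+ (n.+1 - j) - x i ^- (n.+1 - j))) in
  d != 0 ->
  \det (\matrix_(i, j) (x i ^+ m j - x i ^- m j)) / d =
  (-1) ^+ rev_perm * newton_det m (sympl_nodes x).
Proof.
move=> x0 /=.
rewrite (sympl_det_newton (fun j : 'I_n.+1 => (n.+1 - j)%N))//.
rewrite newton_det_staircase sympl_det_newton//.
move: (\prod_i (x i - _)) => a; move: (\prod_(i < n.+1) _) => b.
rewrite !mulf_eq0 !negb_or -!andbA => /and4P[s0 a0 b0 _].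
have : (-1) ^+ rev_perm * (-1) ^+ rev_perm = 1 :> F by rewrite -signr_addb addbb.
move: (_ ^+ _) (newton_det _ _) s0 => s D s0 ss.
apply: (canLR (mulfK _)); first by rewrite !mulf_neq0.
have -> : s * D * (s * a * b * s) = s * s * (s * a * b * D) by ring.
by rewrite ss mul1r.
Qed.

Lemma sympl_det_staircase_neq0 (x : 'I_n.+1 -> F) :
    (forall i, x i != 0) -> (forall i, x i != 1) -> (forall i, x i != -1) ->
    (forall i l : 'I_n.+1, (l < i)%N -> x i != x l) ->
    (forall i l : 'I_n.+1, (l < i)%N -> x i * x l != 1) ->
  \det (\matrix_(i, j) (x i ^+ (n.+1 - j) - x i ^- (n.+1 - j))) != 0.
Proof.
move=> x0 x1 xN1 xx xV.
rewrite (sympl_det_newton (fun j : 'I_n.+1 => (n.+1 - j)%N))//.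
rewrite newton_det_staircase !mulf_neq0 ?signr_eq0//.
  apply/prodf_neq0 => i _.
  have -> : x i - (x i)^-1 = (x i - 1) * (x i - -1) / x i by field.
  by rewrite !mulf_neq0 ?subr_eq0 ?invr_neq0.
apply/prodf_neq0 => i _; apply/prodf_neq0 => l _.
have lt : ((inord (n - i) : 'I_n.+1) < (inord (n - l) : 'I_n.+1))%N.
  rewrite !inordK ?ltnS ?leq_subr// ltn_sub2l//.
  by rewrite (leq_trans (ltn_ord l))// -ltnS.
rewrite /sympl_nodes.
move: (inord (n - i)) (inord (n - l)) lt => a b lt.
have -> : x a + (x a)^-1 - (x b + (x b)^-1)
    = - (x b - x a) * (x b * x a - 1) / (x a * x b) by field; rewrite !x0.
by rewrite !mulf_neq0 ?oppr_eq0 ?invr_neq0 ?mulf_neq0 ?subr_eq0 ?xx ?xV.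
Qed.

End SymplecticDeterminant.

(** * Laurent polynomial functions *)

Lemma poly_everywhere_eq0 (F : numFieldType) (p : {poly F}) :
  (forall t, p.[t] = 0) -> p = 0.
Proof.
move=> p0; apply/eqP/negPn/negP => pn0.
have := max_poly_roots pn0 (rs := mkseq (fun k => k%:R) (size p)).
rewrite size_mkseq ltnn => /(_ _ _)/notF; apply.
  by apply/allP => t _; rewrite rootE p0.
by apply: mkseq_uniq => i j /eqP; rewrite eqr_nat => /eqP.
Qed.

Section LaurentFunctions.
Variables (R : realType) (N : nat).
Local Notation C := R[i].
Implicit Types (f g : ('I_N -> C) -> C).

(** Agreement is asked only at nonzero coordinates, where exponents of monomials add under
    multiplication. *)
Definition laurent_fun f := exists p : laurent R N,
  forall x, (forall i, x i != 0) -> laurent_eval p x = f x.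

Lemma laurent_fun_cst (c : C) : laurent_fun (fun=> c).
Proof.
exists [:: (c, [ffun=> 0])] => x x0; rewrite /laurent_eval big_seq1/=.
by rewrite big1 ?mulr1// => i _; rewrite ffunE expr0z.
Qed.

Lemma laurent_fun_monomial (i : 'I_N) (e : int) : laurent_fun (fun x => x i ^ e).
Proof.
exists [:: (1, [ffun k => if k == i then e else 0])] => x x0.
rewrite /laurent_eval big_seq1/= mul1r (bigD1 i)//= ffunE eqxx big1 ?mulr1// => k ki.
by rewrite ffunE (negbTE ki) expr0z.
Qed.

Lemma laurent_funD f g : laurent_fun f -> laurent_fun g ->
  laurent_fun (fun x => f x + g x).
Proof.
move=> [p pf] [q qg]; exists (p ++ q) => x x0.
by rewrite -pf// -qg// /laurent_eval big_cat.
Qed.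

Lemma laurent_funM f g : laurent_fun f -> laurent_fun g ->
  laurent_fun (fun x => f x * g x).
Proof.
move=> [p pf] [q qg].
pose T := (C * {ffun 'I_N -> int})%type.
exists [seq (t.1 * u.1, [ffun i => t.2 i + u.2 i]) | t : T <- p, u : T <- q] => x x0.
rewrite -pf// -qg// /laurent_eval big_allpairs_dep/= big_distrl/=.
apply: eq_bigr => t _; rewrite big_distrr/=; apply: eq_bigr => u _.
rewrite mulrACA -big_split/=; congr (_ * _); apply: eq_bigr => i _.
by rewrite ffunE expfzDr.
Qed.

Lemma laurent_fun_ext f g : f =1 g -> laurent_fun f -> laurent_fun g.
Proof. by move=> fg [p pf]; exists p => x x0; rewrite pf. Qed.

Lemma laurent_fun_sum I (r : seq I) (P : pred I) (f : I -> ('I_N -> C) -> C) :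
  (forall i, P i -> laurent_fun (f i)) -> laurent_fun (fun x => \sum_(i <- r | P i) f i x).
Proof.
move=> lf; elim: r => [|i r IHr].
  by apply: laurent_fun_ext (laurent_fun_cst 0) => x; rewrite big_nil.
case: (boolP (P i)) => Pi; last first.
  by apply: laurent_fun_ext IHr => x; rewrite big_cons (negbTE Pi).
by apply: laurent_fun_ext (laurent_funD (lf i Pi) IHr) => x; rewrite big_cons Pi.
Qed.

Lemma laurent_fun_prod I (r : seq I) (f : I -> ('I_N -> C) -> C) :
  (forall i, laurent_fun (f i)) -> laurent_fun (fun x => \prod_(i <- r) f i x).
Proof.
move=> lf; elim: r => [|i r IHr].
  by apply: laurent_fun_ext (laurent_fun_cst 1) => x; rewrite big_nil.
by apply: laurent_fun_ext (laurent_funM (lf i) IHr) => x; rewrite big_cons.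
Qed.

Lemma laurent_funX f k : laurent_fun f -> laurent_fun (fun x => f x ^+ k).
Proof.
move=> lf; elim: k => [|k IHk].
  by apply: laurent_fun_ext (laurent_fun_cst 1) => x; rewrite expr0.
by apply: laurent_fun_ext (laurent_funM lf IHk) => x; rewrite exprS.
Qed.

Lemma laurent_fun_det n (A : ('I_N -> C) -> 'M[C]_n) :
  (forall i j, laurent_fun (fun x => A x i j)) -> laurent_fun (fun x => \det (A x)).
Proof.
move=> lA; apply: laurent_fun_sum => s _; apply: laurent_funM.
  exact: laurent_fun_cst.
exact: laurent_fun_prod.
Qed.

(** Synthetic division: coefficient l of the new quotient is coefficient l + 1 of the old one plus
    [z x k] times coefficient l + 1 of the new one. This calls for a descending induction on l,
    started at [size f]. *)
Lemma laurent_fun_newton_quo (z : ('I_N -> C) -> nat -> C) (f : {poly C}) k l :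
  (forall k, laurent_fun (fun x => z x k)) ->
  laurent_fun (fun x => (newton_quo (z x) f k)`_l).
Proof.
move=> lz; elim: k l => [|k IHk] l; first exact: laurent_fun_cst f`_l.
have [d] := ubnP (size f - l); elim: d l => // d IHd l lt_d.
case: (leqP (size f) l) => fl.
  apply: laurent_fun_ext (laurent_fun_cst 0) => x.
  by rewrite nth_default// size_newton_quo (leq_trans (leq_subr _ _)).
have /IHd IH : (size f - l.+1 < d)%N by lia.
apply: laurent_fun_ext (laurent_funD (IHk l.+1) (laurent_funM (lz k) IH)) => x.
rewrite newton_quoS coefD coefC addr0 mulrBr coefB coefMX coefMC/=.
by rewrite [z x k * _]mulrC subrK.
Qed.

Lemma laurent_fun_newton_coef (z : ('I_N -> C) -> nat -> C) (f : {poly C}) k :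
  (forall k, laurent_fun (fun x => z x k)) ->
  laurent_fun (fun x => newton_coef (z x) f k).
Proof.
move=> lz; apply: (laurent_fun_ext
    (f := fun x => \sum_(l < size f) (newton_quo (z x) f k)`_l * z x k ^+ l)) => [x|].
  by rewrite /newton_coef (@horner_coef_wide _ (size f))// size_newton_quo leq_subr.
apply: laurent_fun_sum => l _; apply: laurent_funM; last exact: laurent_funX.
exact: laurent_fun_newton_quo.
Qed.

(** Along a polynomial curve a Laurent polynomial is a rational function of the parameter, which
    reduces identities in several variables to identities between polynomials in one variable. *)
Lemma laurent_along_curve (p : laurent R N) (c : 'I_N -> {poly C}) :
  exists P Q : {poly C}, forall t, (forall i, (c i).[t] != 0) ->
    Q.[t] != 0 /\ laurent_eval p (fun i => (c i).[t]) = P.[t] / Q.[t].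
Proof.
have mono (e : int) i : exists P Q : {poly C}, forall t, (forall i, (c i).[t] != 0) ->
    Q.[t] != 0 /\ (c i).[t] ^ e = P.[t] / Q.[t].
  case: e => e; [exists (c i ^+ e), 1 | exists 1, (c i ^+ e.+1)] => t c0.
    by rewrite hornerC oner_eq0 divr1 horner_exp.
  by rewrite horner_exp expf_neq0// hornerC mul1r NegzE exprnN.
have prd (e : {ffun 'I_N -> int}) (r : seq 'I_N) : exists P Q : {poly C},
    forall t, (forall i, (c i).[t] != 0) ->
    Q.[t] != 0 /\ \prod_(i <- r) (c i).[t] ^ e i = P.[t] / Q.[t].
  elim: r => [|i r [P [Q PQ]]].
    by exists 1, 1 => t _; rewrite hornerC oner_eq0 divr1 big_nil.
  have [P' [Q' PQ']] := mono (e i) i; exists (P' * P), (Q' * Q) => t c0.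
  have [[Q0 E] [Q'0 E']] := (PQ t c0, PQ' t c0).
  by rewrite !hornerM mulf_neq0// big_cons E E' invfM mulrACA.
elim: p => [|[a e] p [P [Q PQ]]].
  by exists 0, 1 => t _; rewrite !hornerC oner_eq0 /laurent_eval big_nil mul0r.
have [P' [Q' PQ']] := prd e (index_enum _).
exists (a%:P * P' * Q + P * Q'), (Q' * Q) => t c0.
have [[Q0 E] [Q'0 E']] := (PQ t c0, PQ' t c0).
rewrite hornerD !hornerM mulf_neq0// hornerC /laurent_eval big_cons/= E'.
rewrite -[\sum_(_ <- _) _]/(laurent_eval p (fun i => (c i).[t])) E; split=> //.
by field; rewrite Q0.
Qed.

End LaurentFunctions.

(** * Symplectic characters *)

Section SymplecticCharacter.
Variables (R : realType) (n : nat).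
Local Notation C := R[i].

(* For all but finitely many [t] the curve [x i + t ^ (i + 1)] avoids the zero
   locus of the denominator. *)
Lemma laurent_identity (p q : laurent R n.+1) :
  (forall x : 'I_n.+1 -> C, (forall i, x i != 0) -> sympl_det (fun=> 0%N) x != 0 ->
     laurent_eval p x = laurent_eval q x) ->
  forall x : 'I_n.+1 -> C, (forall i, x i != 0) -> laurent_eval p x = laurent_eval q x.
Proof.
move=> pq x x0; pose c (i : 'I_n.+1) : {poly C} := 'X^(i.+1) + (x i)%:P.
have ct i t : (c i).[t] = t ^+ i.+1 + x i by rewrite hornerD hornerXn hornerC.
have sizeXnC k (a : C) : size ('X^(k.+1) + a%:P) = k.+2.
  by rewrite size_polyDl size_polyXn// (leq_ltn_trans (size_polyC_leq1 _)).
have XnC0 k (a : C) : 'X^(k.+1) + a%:P != 0 by rewrite -size_poly_gt0 sizeXnC.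
have hA (u : {poly C}) t :
    (u * (u - 1) * (u + 1)).[t] = u.[t] * (u.[t] - 1) * (u.[t] + 1).
  by rewrite !hornerE.
have hB (u v : {poly C}) t :
    ((u - v) * (u * v - 1)).[t] = (u.[t] - v.[t]) * (u.[t] * v.[t] - 1).
  by rewrite !hornerE.
have [P1 [Q1 PQ1]] := laurent_along_curve p c.
have [P2 [Q2 PQ2]] := laurent_along_curve q c.
(* Where [W] is nonzero, the curve has nonzero coordinates and satisfies the conditions that make
   the denominator determinant nonzero. *)
pose W := \prod_(i < n.+1) (c i * (c i - 1) * (c i + 1))
  * \prod_(i < n.+1) \prod_(l < n.+1 | (l < i)%N) ((c i - c l) * (c i * c l - 1)).
have W0 : W != 0.
  rewrite mulf_neq0//; apply/prodf_neq0 => i _.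
    by rewrite !mulf_neq0// /c -?addrA -?polyC1 -?polyCN -?polyCD XnC0.
  apply/prodf_neq0 => l li; rewrite mulf_neq0//.
    (* The coordinates of the curve have pairwise different degrees, hence differ as polynomials. *)
    rewrite subr_eq0; apply/eqP => /(congr1 (fun r : {poly C} => size r)).
    by rewrite /c !sizeXnC; lia.
  rewrite subr_eq0; apply/eqP => /(congr1 (fun r : {poly C} => size r)).
  by rewrite /c size_mul// !sizeXnC size_poly1; lia.
have E0 : (P1 * Q2 - P2 * Q1) * W = 0.
  apply: poly_everywhere_eq0 => t; rewrite hornerM.
  have [->|] := eqVneq W.[t] 0; first by rewrite mulr0.
  rewrite hornerM mulf_eq0 negb_or !horner_prod => /andP[/prodf_neq0 A /prodf_neq0 B].
  have {}A i : [&& (c i).[t] != 0, (c i).[t] != 1 & (c i).[t] != -1].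
    have := A i isT; rewrite hA 2!mulf_eq0 2!negb_or.
    by rewrite subr_eq0 addr_eq0 -andbA.
  have {}B (i l : 'I_n.+1) : (l < i)%N ->
      ((c i).[t] != (c l).[t]) && ((c i).[t] * (c l).[t] != 1).
    move=> li; have := B i isT; rewrite horner_prod => /prodf_neq0/(_ l li).
    rewrite hB mulf_eq0 negb_or.
    by rewrite !subr_eq0.
  have ct0 i : (c i).[t] != 0 by have /and3P[] := A i.
  have [Q10 E1] := PQ1 t ct0; have [Q20 E2] := PQ2 t ct0.
  have := pq (fun i => (c i).[t]) ct0.
  rewrite E1 E2 => H; rewrite hornerD hornerN !hornerM; apply/eqP.
  rewrite mulf_eq0 subr_eq0 -eqr_div// H ?eqxx//.
  apply: sympl_det_staircase_neq0 => // [i|i|i l li|i l li].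
  - by have /and3P[] := A i.
  - by have /and3P[] := A i.
  - by have /andP[] := B i l li.
  - by have /andP[] := B i l li.
(* [W] may vanish at 0, so it is cancelled as a polynomial before evaluating at 0, where the curve
   passes through [x]. *)
move/eqP: E0; rewrite mulf_eq0 (negbTE W0) orbF subr_eq0 => /eqP/(congr1 (horner^~ 0)).
have c0 i : (c i).[0] = x i by rewrite ct exprS mul0r add0r.
have xc : (fun i => (c i).[0]) = x by apply/funext.
have c0' i : (c i).[0] != 0 by rewrite c0.
have [Q10 E1] := PQ1 0 c0'; have [Q20 E2] := PQ2 0 c0'.
rewrite xc in E1 E2; rewrite E1 E2 !hornerM => H.
by apply/eqP; rewrite eqr_div// H.
Qed.

(** The right-hand side is a Laurent polynomial function and equals the quotient of determinants
    wherever that is defined. The list chosen by [xget] agrees with it there, hence at all points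
    with nonzero coordinates. *)
Lemma sympl_charE (lam : 'I_n.+1 -> nat) (x : 'I_n.+1 -> C) : (forall i, x i != 0) ->
  sympl_char lam x =
  (-1) ^+ perm (@rev_ord_inj n.+1) * newton_det (shifted lam) (sympl_nodes x).
Proof.
have [p pE] : laurent_fun (fun x : 'I_n.+1 -> C =>
    (-1) ^+ perm (@rev_ord_inj n.+1) * newton_det (shifted lam) (sympl_nodes x)).
  apply: laurent_funM; first exact: laurent_fun_cst ((-1) ^+ perm (@rev_ord_inj n.+1)).
  apply: laurent_fun_det => i j.
  apply: (laurent_fun_ext (f := fun x =>
    newton_coef (sympl_nodes x) (sympl_poly _ (shifted lam j)) i)) => [y|].
    by rewrite mxE.
  apply: laurent_fun_newton_coef => k; apply: laurent_funD.
    exact: laurent_fun_monomial (inord (n - k)) 1.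
  exact: laurent_fun_monomial (inord (n - k)) (-1).
have prep : represents_sympl_char lam p.
  by move=> y y0 d0; rewrite pE//; apply/esym/sympl_det_quotient.
move=> x0; rewrite -pE//; move: x x0; apply: laurent_identity => x x0 d0.
by rewrite prep// (xgetPex [::] (ex_intro _ p prep)).
Qed.

Lemma shifted_gt0 N (lam : 'I_N -> nat) j : (0 < shifted lam j)%N.
Proof. by rewrite /shifted addn_gt0 subn_gt0 ltn_ord orbT. Qed.

Lemma shifted_inj N (lam : 'I_N -> nat) :
  (forall i j : 'I_N, (i <= j)%N -> (lam j <= lam i)%N) -> injective (shifted lam).
Proof.
move=> lamP.
have lt (i j : 'I_N) : (i < j)%N -> (shifted lam j < shifted lam i)%N.
  move=> ij; rewrite /shifted; have := lamP _ _ (ltnW ij); have := ltn_ord j; lia.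
move=> i j E; apply/val_inj/eqP; case: ltngtP => // /lt; by rewrite E ltnn.
Qed.

(** At x, 1, ..., 1 the nodes are 2, ..., 2, x + 1/x, and the reversal signs of numerator and
    denominator cancel. *)
Lemma normalized_sympl_charE (lam : 'I_n.+1 -> nat) (x : C) :
    (forall i j : 'I_n.+1, (i <= j)%N -> (lam j <= lam i)%N) ->
    x != 0 -> x != 1 -> x != -1 ->
  normalized_sympl_char lam x =
  (n.*2.+1`!)%:R / ((x - x^-1) * (x + x^-1 - 2) ^+ n) *
  \sum_j (x ^+ shifted lam j - x ^- shifted lam j) / (shifted lam j)%:R
     * lagrange_weight (fun j => (shifted lam j)%:R ^+ 2) j.
Proof.
move=> lamP x0 x1 xN1.
have shinj := shifted_inj lamP; have sh0 := shifted_gt0 lam.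
rewrite /normalized_sympl_char !sympl_charE; last 2 first.
- by move=> _; rewrite oner_eq0.
- by move=> i; case: ifP; rewrite ?oner_eq0.
have -> : @sympl_nodes C n (fun=> 1) = (fun=> 2).
  by apply/funext => k; rewrite /sympl_nodes invr1.
have -> : @sympl_nodes C n (fun i => if val i == 0%N then x else 1) =
    (fun k => if (k < n)%N then 2 else x + x^-1).
  apply/funext => k; rewrite /sympl_nodes /= inordK ?ltnS ?leq_subr//.
  by rewrite subn_eq0 leqNgt; case: ltnP => //= _; rewrite invr1.
rewrite -mulf_div divff ?signr_eq0// mul1r newton_det_ratio//; last first.
  rewrite -subr_eq0; have -> : x + x^-1 - 2 = (x - 1) ^+ 2 / x by field.
  by rewrite mulf_neq0 ?invr_neq0// expf_neq0// subr_eq0.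
have d0 : x - x^-1 != 0.
  have -> : x - x^-1 = (x - 1) * (x - -1) / x by field.
  by rewrite !mulf_neq0 ?invr_neq0// subr_eq0.
rewrite invfM -!mulrA; congr (_ * _).
rewrite [RHS]mulrCA; congr (_ * _); rewrite mulr_sumr; apply: eq_bigr => j _.
by rewrite -sympl_polyE// -!mulrA mulKf.
Qed.

End SymplecticCharacter.

(** * Estimates on the complex exponential *)

Section ComplexL1.
Variable R : realType.
Implicit Types z w : R[i].
Local Notation Re := (@complex.Re R).
Local Notation Im := (@complex.Im R).

Lemma Re_mul z w : Re (z * w) = Re z * Re w - Im z * Im w.
Proof. by case: z => ? ?; case: w. Qed.

Lemma Im_mul z w : Im (z * w) = Re z * Im w + Im z * Re w.
Proof. by case: z => ? ?; case: w. Qed.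

Lemma Re_add z w : Re (z + w) = Re z + Re w.
Proof. by case: z => ? ?; case: w. Qed.

Lemma Im_add z w : Im (z + w) = Im z + Im w.
Proof. by case: z => ? ?; case: w. Qed.

Lemma Re_opp z : Re (- z) = - Re z.
Proof. by case: z. Qed.

Lemma Im_opp z : Im (- z) = - Im z.
Proof. by case: z. Qed.

Lemma Re_inv z : Re z^-1 = Re z / (Re z ^+ 2 + Im z ^+ 2).
Proof. by case: z. Qed.

Lemma Im_inv z : Im z^-1 = - Im z / (Re z ^+ 2 + Im z ^+ 2).
Proof. by case: z => a b; rewrite mulNr. Qed.

Lemma complex_eqP z w : Re z = Re w -> Im z = Im w -> z = w.
Proof. by case: z => a b; case: w => c d /= -> ->. Qed.

(* Up to a constant factor this is the modulus; unlike [`|z|] it takes values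
   in the reals. *)
Definition norm1 z : R := `|Re z| + `|Im z|.

Lemma norm1_ge0 z : 0 <= norm1 z.
Proof. by rewrite addr_ge0. Qed.

Lemma norm1_eq0 z : norm1 z = 0 -> z = 0.
Proof.
move=> /eqP; rewrite paddr_eq0// !normr_eq0 => /andP[/eqP a /eqP b].
exact: complex_eqP.
Qed.

Lemma norm1D z w : norm1 (z + w) <= norm1 z + norm1 w.
Proof. by rewrite /norm1 Re_add Im_add addrACA lerD// ler_normD. Qed.

Lemma norm1M z w : norm1 (z * w) <= norm1 z * norm1 w.
Proof.
rewrite /norm1 Re_mul Im_mul.
have H1 := ler_normB (Re z * Re w) (Im z * Im w).
have H2 := ler_normD (Re z * Im w) (Im z * Re w).
rewrite !normrM in H1 H2; apply: (le_trans (lerD H1 H2)).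
by rewrite le_eqVlt; apply/orP; left; apply/eqP; ring.
Qed.

Lemma norm1_sum n (f : 'I_n -> R[i]) : norm1 (\sum_i f i) <= \sum_i norm1 (f i).
Proof.
elim/big_ind2: _ => [|z a w b za wb|//]; first by rewrite /norm1 /= normr0 addr0.
by rewrite (le_trans (norm1D _ _))// lerD.
Qed.

Lemma norm1_real (r : R) : norm1 r%:C = `|r|.
Proof. by rewrite /norm1/= normr0 addr0. Qed.

Lemma cexpD z w : cexp (z + w) = cexp z * cexp w.
Proof.
apply: complex_eqP; rewrite ?Re_mul ?Im_mul /cexp/= Re_add Im_add expRD ?cosD ?sinD; ring.
Qed.

Lemma cexp0 : cexp 0 = 1 :> R[i].
Proof. by rewrite /cexp/= expR0 cos0 sin0 mulr1 mulr0. Qed.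

Lemma cexpN z : cexp (- z) = (cexp z)^-1.
Proof.
have : cexp (- z) * cexp z = 1 by rewrite -cexpD addNr cexp0.
have [->|z0] := eqVneq (cexp z) 0; first by rewrite mulr0 => /eqP; rewrite eq_sym oner_eq0.
by move=> /(canRL (mulfK z0)); rewrite mul1r.
Qed.

Lemma cexpMn n z : cexp (n%:R * z) = cexp z ^+ n.
Proof.
elim: n => [|n IHn]; first by rewrite mul0r cexp0.
by rewrite -addn1 natrD mulrDl mul1r cexpD IHn exprD expr1.
Qed.

Lemma norm1_cexp z : norm1 (cexp z) <= 2 * expR (norm1 z).
Proof.
have H : expR (Re z) <= expR (norm1 z).
  by rewrite ler_expR (le_trans (ler_norm _))// lerDl.
rewrite /norm1 /cexp/= !normrM ger0_norm ?expR_ge0// -mulrDr mulrC.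
rewrite ler_pM ?addr_ge0 ?expR_ge0//.
by rewrite -[2]/(1 + 1) lerD// ?cos_max ?sin_max.
Qed.

(** Covers both signs of [x]; the bound on the intermediate point lets the estimates below be
    iterated. *)
Lemma mean_value_at0 (f df : R -> R) (x : R) : (forall y : R, is_derive y 1 f (df y)) ->
  exists2 c, `|c| <= `|x| & f x - f 0 = df c * x.
Proof.
move=> fdf; have cf a b : {within `[a, b], continuous f}.
  apply: continuous_subspaceT => y.
  by apply/differentiable_continuous/derivable1_diffP; exact: ex_derive.
have [x0|x0] := leP 0 x.
  have [c] := MVT_segment x0 (fun y _ => fdf y) (cf _ _).
  rewrite in_itv/= subr0 => /andP[c0 cx] E.
  by exists c => //; rewrite !ger0_norm.
have [c] := MVT_segment (ltW x0) (fun y _ => fdf y) (cf _ _).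
rewrite in_itv/= => /andP[xc c0] E.
exists c; first by rewrite !ler0_norm ?lerN2// ltW.
by rewrite -opprB E sub0r mulrN opprK.
Qed.

Lemma sin_le_norm (x : R) : `|sin x| <= `|x|.
Proof.
have [c _] := mean_value_at0 x (@is_derive_sin R).
by rewrite sin0 subr0 => ->; rewrite normrM ler_piMl// cos_max.
Qed.

Lemma cosB1_le (x : R) : `|cos x - 1| <= x ^+ 2.
Proof.
have [c cx] := mean_value_at0 x (@is_derive_cos R).
rewrite cos0 => ->; rewrite normrM normrN -[x ^+ 2]real_normK ?num_real// expr2 ler_wpM2r//.
exact: le_trans (sin_le_norm c) cx.
Qed.

Lemma sinBid_le (x : R) : `|sin x - x| <= x ^+ 2.
Proof.
have D (y : R) : is_derive y 1 (fun t : R => sin t - t) (cos y - 1).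
  by apply: is_deriveB.
have [c cx] := mean_value_at0 x D.
rewrite sin0 !subr0 => ->; rewrite normrM -[x ^+ 2]real_normK ?num_real// expr2 ler_wpM2r//.
have [d _] := mean_value_at0 c (@is_derive_cos R).
rewrite cos0 => ->; rewrite normrM normrN (le_trans _ cx)// ler_piMl//; exact: sin_max.
Qed.

Lemma expRB1_le (x : R) : `|expR x - 1| <= `|x| * expR `|x|.
Proof.
have [c cx] := mean_value_at0 x (@is_derive_expR R).
rewrite expR0 => ->; rewrite normrM mulrC ler_wpM2l// ger0_norm ?expR_ge0//.
by rewrite ler_expR (le_trans (ler_norm _)).
Qed.

Lemma expRB1id_le (x : R) : `|expR x - 1 - x| <= x ^+ 2 * expR `|x|.
Proof.
have D (y : R) : is_derive y 1 (fun t : R => expR t - t) (expR y - 1).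
  by apply: is_deriveB.
have [c cx] := mean_value_at0 x D.
rewrite expR0 subr0 addrAC => ->; rewrite normrM mulrC -[x ^+ 2]real_normK ?num_real// expr2.
rewrite -mulrA ler_wpM2l// (le_trans (expRB1_le c))// ler_pM// ?expR_ge0//.
by rewrite ler_expR.
Qed.

(** The quadratic order in [z] is what the later subdivision argument relies on. Each component is
    split so that the real estimates for [expR], [cos] and [sin] apply separately. *)
Lemma cexpB1id_le z : norm1 (cexp z - 1 - z) <= 2 * norm1 z ^+ 2 * expR (norm1 z).
Proof.
case: z => a b; rewrite /norm1 /cexp/= subr0.
have A := expRB1_le a; have B := expRB1id_le a.
have C := cosB1_le b; have D := sinBid_le b.
set E := expR `|a| in A B *; set F := expR (`|a| + `|b|).
have EF : E <= F by rewrite ler_expR lerDl.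
have e0 := expR_gt0 a.
have eF : expR a <= F by rewrite ler_expR (le_trans (ler_norm a))// lerDl.
have F0 : 0 <= F by exact: expR_ge0.
have -> : expR a * cos b - 1 - a = expR a * (cos b - 1) + (expR a - 1 - a) by ring.
have -> : expR a * sin b - b = expR a * (sin b - b) + (expR a - 1) * b by ring.
have H1 : `|expR a * (cos b - 1) + (expR a - 1 - a)| <= F * b ^+ 2 + a ^+ 2 * F.
  rewrite (le_trans (ler_normD _ _))// normrM lerD//.
    by rewrite ler_pM// gtr0_norm.
  by rewrite (le_trans B)// ler_wpM2l// sqr_ge0.
have H2 : `|expR a * (sin b - b) + (expR a - 1) * b| <= F * b ^+ 2 + `|a| * F * `|b|.
  rewrite (le_trans (ler_normD _ _))// !normrM lerD//.
    by rewrite ler_pM// gtr0_norm.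
  by rewrite ler_wpM2r// (le_trans A)// ler_wpM2l.
apply: (le_trans (lerD H1 H2)).
rewrite -[b ^+ 2]real_normK ?num_real// -[a ^+ 2]real_normK ?num_real//.
rewrite -subr_ge0 (_ : _ - _ = F * (`|a| ^+ 2 + `|a| * `|b| *+ 3)); last by ring.
by rewrite mulr_ge0// addr_ge0 ?sqr_ge0// mulrn_wge0// mulr_ge0.
Qed.

End ComplexL1.

(** * Integrals of real functions *)

Section RealIntegrals.
Variable R : realType.
Notation mu := (@lebesgue_measure R).
Implicit Types (a b : R) (f g F : R -> R).

Lemma within_bounded a b f : {within `[a, b], continuous f} ->
  exists2 M, 0 < M & forall t, t \in `[a, b] -> `|f t| <= M.
Proof.
move=> cf; have /compact_bounded[M [_ HM]] :=
  @continuous_compact _ R f _ cf (@segment_compact R a b).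
exists (`|M| + 1); first by rewrite ltr_wpDl.
move=> t tab; apply: HM; first by rewrite ltr_pwDr// ler_norm.
by exists t.
Qed.

Lemma itvoo_ends (a b t : R) : t \in `[a, b] -> [\/ t = a, t = b | t \in `]a, b[].
Proof.
rewrite !in_itv/= => /andP[]; rewrite le_eqVlt => /predU1P[->|at_]; first by constructor 1.
rewrite le_eqVlt => /predU1P[->|tb]; first by constructor 2.
by constructor 3; rewrite at_.
Qed.

Lemma withinD (A : set R) f g : {within A, continuous f} ->
  {within A, continuous g} -> {within A, continuous (fun t => f t + g t)}.
Proof. by move=> cf cg x; exact: (continuousD (cf x) (cg x)). Qed.

Lemma withinM (A : set R) f g : {within A, continuous f} ->
  {within A, continuous g} -> {within A, continuous (fun t => f t * g t)}.
Proof. by move=> cf cg x; exact: (continuousM (cf x) (cg x)). Qed.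

Lemma withinN (A : set R) f : {within A, continuous f} ->
  {within A, continuous (fun t => - f t)}.
Proof. by move=> cf x; exact: (continuousN (cf x)). Qed.

Lemma within_comp (A : set R) f g : {within A, continuous f} ->
  continuous g -> {within A, continuous (fun t => g (f t))}.
Proof. by move=> cf cg x; exact: (continuous_comp (cf x) (cg _)). Qed.

(** The velocity of a piecewise C1 path may jump at the break points, so continuity is replaced by
    this weaker condition, which still gives integrability. *)
Definition bounded_measurable a b f :=
  measurable_fun `[a, b] f /\ exists M, forall t, t \in `[a, b] -> `|f t| <= M.

Lemma bounded_measurable_integrable a b f : bounded_measurable a b f ->
  mu.-integrable `[a, b] (EFin \o f).
Proof.
move=> [mf [M fM]]; apply: measurable_bounded_integrable => //=.
  rewrite lebesgue_measure_itv/=; case: ifP => // _; by rewrite -EFinB ltry.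
exists M; split; first exact: num_real.
by move=> K MK t /= tab; rewrite (le_trans (fM t tab))// ltW.
Qed.

Lemma bounded_measurableD a b f g : bounded_measurable a b f ->
  bounded_measurable a b g -> bounded_measurable a b (fun t => f t + g t).
Proof.
move=> [mf [M fM]] [mg [K gK]]; split; first exact: measurable_funD.
by exists (M + K) => t tab; rewrite (le_trans (ler_normD _ _))// lerD ?fM ?gK.
Qed.

Lemma bounded_measurableM a b f g : bounded_measurable a b f ->
  bounded_measurable a b g -> bounded_measurable a b (fun t => f t * g t).
Proof.
move=> [mf [M fM]] [mg [K gK]]; split; first exact: measurable_funM.
by exists (M * K) => t tab; rewrite normrM ler_pM ?fM ?gK.
Qed.

Lemma bounded_measurableN a b f : bounded_measurable a b f ->
  bounded_measurable a b (fun t => - f t).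
Proof.
move=> [mf [M fM]]; split; first exact: measurable_funN.
by exists M => t tab; rewrite normrN fM.
Qed.

Lemma bounded_measurable_eq_oo a b f g : {within `[a, b], continuous g} ->
  {in `]a, b[, f =1 g} -> bounded_measurable a b f.
Proof.
move=> cg fg; have [M M0 gM] := within_bounded cg; split.
  apply: (@measurable_fun_itv_cc _ _ _ false true).
  apply: (eq_measurable_fun g); first by move=> t; rewrite inE/= => /fg.
  apply: (@measurable_funS _ _ _ _ `[a, b]) => //; first exact: subset_itv_oo_cc.
  by apply: subspace_continuous_measurable_fun.
exists (M + `|f a| + `|f b|) => t /itvoo_ends[->|->|tab].
- by rewrite -addrA addrCA lerDl addr_ge0// ltW.
- by rewrite lerDr addr_ge0// ltW.
- rewrite fg// -addrA (le_trans (gM t _)) ?lerDl ?addr_ge0//.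
  exact: subset_itv_oo_cc.
Qed.

Lemma continuous_bounded_measurable a b f : {within `[a, b], continuous f} ->
  bounded_measurable a b f.
Proof. by move=> cf; exact: (bounded_measurable_eq_oo cf). Qed.

(** The integrand may take any value at the endpoints, a null set. This matters because [derive1] at
    the end of a piece need not be the one-sided derivative. *)
Lemma FTC_eq_oo a b f g F : a < b -> {within `[a, b], continuous g} ->
  {in `]a, b[, f =1 g} -> {within `[a, b], continuous F} ->
  (forall t, t \in `]a, b[ -> is_derive t 1 F (g t)) ->
  \int[mu]_(t in `[a, b]) f t = F b - F a.
Proof.
move=> ab cg fg cF dF.
have E : \int[mu]_(t in `[a, b]) f t = \int[mu]_(t in `[a, b]) g t.
  have oo h : mu.-integrable `[a, b] (EFin \o h) ->
      \int[mu]_(t in `[a, b]) h t = \int[mu]_(t in `]a, b[) h t.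
    move=> ih; rewrite -Rintegral_itv_obnd_cbnd.
      rewrite -Rintegral_itv_bndo_bndc//; apply: integrableS ih => //.
      exact: subset_itv_oo_cc.
    by apply: integrableS ih => //; exact: subset_itv_oc_cc.
  rewrite oo; last exact/bounded_measurable_integrable/(bounded_measurable_eq_oo cg).
  rewrite oo; last exact/bounded_measurable_integrable/continuous_bounded_measurable.
  by apply: eq_Rintegral => t; rewrite inE/= => /fg.
rewrite E /Rintegral (continuous_FTC2 ab cg (F := F))//.
- have /(continuous_within_itvP _ ab)[_ Fa Fb] := cF; split=> // t /dF dt.
  exact: ex_derive.
- by move=> t /dF dt; rewrite derive1E derive_val.
Qed.

Lemma Rintegral_split a u b f : a <= u -> u <= b ->
  mu.-integrable `[a, b] (EFin \o f) ->
  \int[mu]_(t in `[a, b]) f t =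
  \int[mu]_(t in `[a, u]) f t + \int[mu]_(t in `[u, b]) f t.
Proof.
move=> au ub iF; apply/eqP; rewrite addrC -subr_eq Rintegral_itvB ?bnd_simp//.
rewrite Rintegral_itv_obnd_cbnd//; apply: integrableS iF => //.
by apply: subset_itvr; rewrite bnd_simp.
Qed.

Lemma itv_cc_setU a u b : a <= u -> u <= b ->
  `[a, b]%classic = `[a, u] `|` `[u, b] :> set R.
Proof.
move=> au ub; apply/seteqP; split=> t /=; rewrite !in_itv/=.
  by move=> /andP[-> ->]; rewrite andbT/=; apply/orP; exact: le_total.
by case=> /andP[H1 H2]; apply/andP; split=> //; apply: le_trans; eassumption.
Qed.

Lemma bounded_measurable_glue a u b f : a <= u -> u <= b ->
  bounded_measurable a u f -> bounded_measurable u b f -> bounded_measurable a b f.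
Proof.
move=> au ub [m1 [M fM]] [m2 [K fK]]; split.
  by rewrite (itv_cc_setU au ub); exact/measurable_funU.
exists (Num.max M K) => t tab.
have : (`[a, u] `|` `[u, b]) t by rewrite -itv_cc_setU.
by rewrite le_max => -[/fM ->|/fK ->]; rewrite ?orbT.
Qed.

Lemma within_glue a u b f : a <= u -> u <= b ->
  {within `[a, u], continuous f} -> {within `[u, b], continuous f} ->
  {within `[a, b], continuous f}.
Proof.
move=> au ub c1 c2; rewrite (itv_cc_setU au ub).
by apply: withinU_continuous => //; exact: itv_closed.
Qed.

End RealIntegrals.

(** * Integrals of complex functions *)

Section ComplexIntegrals.
Variable R : realType.
Notation mu := (@lebesgue_measure R).
Implicit Types (a b : R) (h k : R -> R[i]).
Local Notation Re := (@complex.Re R).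
Local Notation Im := (@complex.Im R).

Definition ccontinuous_on a b h :=
  {within `[a, b], continuous (fun t => Re (h t))} /\
  {within `[a, b], continuous (fun t => Im (h t))}.

Definition cbounded_measurable a b h :=
  bounded_measurable a b (fun t => Re (h t)) /\
  bounded_measurable a b (fun t => Im (h t)).

Lemma ccontinuous_on_ext a b h k : h =1 k -> ccontinuous_on a b h -> ccontinuous_on a b k.
Proof. by move=> /funext ->. Qed.

Lemma ccontinuous_on_cst a b (c : R[i]) : ccontinuous_on a b (fun=> c).
Proof. by split=> x; exact: cst_continuous. Qed.

Lemma ccontinuous_onD a b h k : ccontinuous_on a b h -> ccontinuous_on a b k ->
  ccontinuous_on a b (fun t => h t + k t).
Proof.
move=> [h1 h2] [k1 k2]; split.
  by rewrite (funext (fun t => Re_add (h t) (k t))); exact: withinD.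
by rewrite (funext (fun t => Im_add (h t) (k t))); exact: withinD.
Qed.

Lemma ccontinuous_onM a b h k : ccontinuous_on a b h -> ccontinuous_on a b k ->
  ccontinuous_on a b (fun t => h t * k t).
Proof.
move=> [h1 h2] [k1 k2]; split.
  rewrite (funext (fun t => Re_mul (h t) (k t))).
  exact: withinD (withinM h1 k1) (withinN (withinM h2 k2)).
rewrite (funext (fun t => Im_mul (h t) (k t))).
exact: withinD (withinM h1 k2) (withinM h2 k1).
Qed.

Lemma ccontinuous_onV a b h : (forall t, t \in `[a, b] -> h t != 0) ->
  ccontinuous_on a b h -> ccontinuous_on a b (fun t => (h t)^-1).
Proof.
move=> h0 [h1 h2].
have iV : {within `[a, b], continuous (fun t => (Re (h t) ^+ 2 + Im (h t) ^+ 2)^-1)}.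
  have c2 := withinD (withinM h1 h1) (withinM h2 h2).
  apply/subspace_continuousP => t tab; apply: cvgV.
    rewrite paddr_eq0 ?sqr_ge0// !sqrf_eq0; apply: contra (h0 t tab) => /andP[/eqP r /eqP i].
    by apply/eqP; apply: complex_eqP.
  by move/subspace_continuousP : c2 => /(_ t tab).
split.
  by rewrite (funext (fun t => Re_inv (h t))); exact: withinM.
by rewrite (funext (fun t => Im_inv (h t))); exact: withinM (withinN h2) iV.
Qed.

Lemma ccontinuous_on_cexp a b h : ccontinuous_on a b h ->
  ccontinuous_on a b (fun t => cexp (h t)).
Proof.
move=> [h1 h2]; have e := within_comp h1 (@continuous_expR R).
by split; apply: withinM => //; apply: within_comp => //;
  [exact: continuous_cos|exact: continuous_sin].
Qed.

Lemma ccontinuous_on_bounded_measurable a b h :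
  ccontinuous_on a b h -> cbounded_measurable a b h.
Proof. by move=> [? ?]; split; exact: continuous_bounded_measurable. Qed.

Lemma cbounded_measurableD a b h k : cbounded_measurable a b h ->
  cbounded_measurable a b k -> cbounded_measurable a b (fun t => h t + k t).
Proof.
move=> [h1 h2] [k1 k2]; split.
  by rewrite (funext (fun t => Re_add (h t) (k t))); exact: bounded_measurableD.
by rewrite (funext (fun t => Im_add (h t) (k t))); exact: bounded_measurableD.
Qed.

Lemma cbounded_measurableM a b h k : cbounded_measurable a b h ->
  cbounded_measurable a b k -> cbounded_measurable a b (fun t => h t * k t).
Proof.
move=> [h1 h2] [k1 k2]; split.
  rewrite (funext (fun t => Re_mul (h t) (k t))); apply: bounded_measurableD.
    exact: bounded_measurableM.
  by apply/bounded_measurableN/bounded_measurableM.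
rewrite (funext (fun t => Im_mul (h t) (k t))).
by apply: bounded_measurableD; exact: bounded_measurableM.
Qed.

Lemma cbounded_measurable_cst a b (c : R[i]) : cbounded_measurable a b (fun=> c).
Proof. exact/ccontinuous_on_bounded_measurable/ccontinuous_on_cst. Qed.

Lemma norm1_bounded a b h : cbounded_measurable a b h ->
  exists2 M, 0 <= M & forall t, t \in `[a, b] -> norm1 (h t) <= M.
Proof.
move=> [[_ [M HM]] [_ [K HK]]]; exists (`|M| + `|K|); first by rewrite addr_ge0.
move=> t tab; rewrite lerD//.
  by rewrite (le_trans (HM t tab))// ler_norm.
by rewrite (le_trans (HK t tab))// ler_norm.
Qed.

Lemma cintegral_ext a b h k : (forall t, t \in `[a, b] -> h t = k t) ->
  cintegral a b h = cintegral a b k.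
Proof.
by move=> hk; congr (_ +i* _); apply: eq_Rintegral => t; rewrite inE/= => /hk ->.
Qed.

Lemma cintegralD a b h k : cbounded_measurable a b h -> cbounded_measurable a b k ->
  cintegral a b (fun t => h t + k t) = cintegral a b h + cintegral a b k.
Proof.
move=> [h1 h2] [k1 k2]; apply: complex_eqP; rewrite ?Re_add ?Im_add /=.
  by under eq_Rintegral do rewrite Re_add; rewrite RintegralD//;
    exact: bounded_measurable_integrable.
by under eq_Rintegral do rewrite Im_add; rewrite RintegralD//;
    exact: bounded_measurable_integrable.
Qed.

Lemma cintegralZ a b (c : R[i]) h : cbounded_measurable a b h ->
  cintegral a b (fun t => c * h t) = c * cintegral a b h.
Proof.
move=> [h1 h2].
have Z f (r : R) : bounded_measurable a b f ->
    mu.-integrable `[a, b] (EFin \o (fun t => r * f t)).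
  move=> bf; apply/bounded_measurable_integrable/bounded_measurableM => //.
  by apply/continuous_bounded_measurable => x; exact: cst_continuous.
apply: complex_eqP; rewrite ?Re_mul ?Im_mul /=.
  under eq_Rintegral do rewrite Re_mul; rewrite RintegralB ?Z// !RintegralZl//;
    exact: bounded_measurable_integrable.
under eq_Rintegral do rewrite Im_mul; rewrite RintegralD ?Z// !RintegralZl//;
    exact: bounded_measurable_integrable.
Qed.

Lemma cintegral_sum n a b (h : 'I_n -> R -> R[i]) :
  (forall i, cbounded_measurable a b (h i)) ->
  cintegral a b (fun t => \sum_i h i t) = \sum_i cintegral a b (h i).
Proof.
elim: n h => [|n IHn] h bh.
  rewrite big_ord0 /cintegral; under eq_Rintegral do rewrite big_ord0.
  under [X in _ +i* X]eq_Rintegral do rewrite big_ord0.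
  by rewrite /= Rintegral_cst// mul0r.
rewrite big_ord_recl -IHn// -cintegralD//.
  by apply: cintegral_ext => t _; rewrite big_ord_recl.
(* The side condition left, that the tail of the sum is bounded and measurable, takes an induction
   of its own. *)
elim: {IHn} n h bh => [|n IHn] h bh.
  apply: (@eq_ind _ _ (cbounded_measurable a b) (cbounded_measurable_cst a b 0)).
  by apply/funext => t; rewrite big_ord0.
have := cbounded_measurableD (bh (lift ord0 ord0)) (IHn (fun i => h (lift ord0 i)) _).
move=> H; apply: (@eq_ind _ _ (cbounded_measurable a b) (H _)) => //.
by apply/funext => t; rewrite big_ord_recl.
Qed.

(** Real and imaginary parts are each bounded by M (b - a), whence the factor 2. *)
Lemma norm1_cintegral a b h M : a <= b -> cbounded_measurable a b h ->
  (forall t, t \in `[a, b] -> norm1 (h t) <= M) ->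
  norm1 (cintegral a b h) <= 2 * M * (b - a).
Proof.
move=> ab [h1 h2] hM.
have bound f : bounded_measurable a b f -> (forall t, t \in `[a, b] -> `|f t| <= M) ->
    `|\int[mu]_(t in `[a, b]) f t| <= M * (b - a).
  move=> bf fM; have iF := bounded_measurable_integrable bf.
  apply: (le_trans (le_normr_Rintegral _ iF)) => //.
  have -> : M * (b - a) = \int[mu]_(t in `[a, b]) M.
    rewrite Rintegral_cst//= lebesgue_measure_itv/= lte_fin.
    case: ltP => [_|ba]; first by rewrite -EFinB.
    have -> : b = a by apply/le_anti/andP.
    by rewrite subrr.
  apply: le_Rintegral => //; first exact: integrable_norm.
  apply/bounded_measurable_integrable/continuous_bounded_measurable => x.
  exact: cst_continuous.
rewrite /norm1 -mulrA mulr_natl mulr2n lerD//= bound// => t tab;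
  by rewrite (le_trans _ (hM t tab))// ?lerDl ?lerDr.
Qed.

Lemma cintegral_split a u b h : a <= u -> u <= b -> cbounded_measurable a b h ->
  cintegral a b h = cintegral a u h + cintegral u b h.
Proof.
move=> au ub [h1 h2]; rewrite /cintegral (Rintegral_split au ub); last first.
  exact: bounded_measurable_integrable.
by rewrite (@Rintegral_split _ a u b)//; exact: bounded_measurable_integrable.
Qed.

End ComplexIntegrals.

(** * Contour integrals *)

Section Contours.
Variable R : realType.
Implicit Types (a b : R) (gam : R -> R[i]).
Local Notation Re := (@complex.Re R).
Local Notation Im := (@complex.Im R).

(** Properties of piecewise C1 paths reduce to a single C1 piece and to concatenation at an interior
    break point. *)
Lemma piecewise_C1_ind gam (P : R -> R -> Prop) :
  (forall a b, a < b -> C1_on a b (re_path gam) -> C1_on a b (im_path gam) -> P a b) ->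
  (forall a u b, a < u -> u < b -> P a u -> P u b -> P a b) ->
  forall a b, a < b -> piecewise_C1 a b gam -> P a b.
Proof.
move=> Pbase Pglue a b ab [s [+ + Hs]].
elim: s a ab Hs => [|u s IHs] a ab Hs; first by move=> _ /= E; rewrite E ltxx in ab.
move=> /= /andP[au us] lastb.
have Pau : P a u by have [] := Hs 0%N isT; exact: Pbase.
case: s IHs Hs us lastb => [_ _ _ /= <- //|v s IHs Hs us lastb].
have ub : u < b.
  have /allP/(_ (last v s)) : all (>%R^~ u) (v :: s).
    by apply: order_path_min us; exact: lt_trans.
  by rewrite mem_last/= -lastb; apply.
apply: (Pglue _ u) => //; apply: IHs => // k ks.
have := Hs k.+1 ks.
(* The default of [nth] is the left end of the interval, which changes from [a] to [u] once the
   first piece is dropped; the indices are in range, so the values agree. *)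
by rewrite -!(set_nth_default a u)//= ltnW.
Qed.

Lemma path_velocity_C1 a b gam : C1_on a b (re_path gam) -> C1_on a b (im_path gam) ->
  exists2 g, ccontinuous_on a b g & forall t, t \in `]a, b[ ->
    [/\ is_derive t 1 (re_path gam) (Re (g t)), is_derive t 1 (im_path gam) (Im (g t)) &
        path_velocity gam t = g t].
Proof.
move=> [_ [g1 [c1 d1]]] [_ [g2 [c2 d2]]]; exists (fun t => g1 t +i* g2 t) => // t tab.
split; [exact: d1|exact: d2|].
have D1 := d1 t tab; have D2 := d2 t tab.
by rewrite /path_velocity !derive1E !derive_val.
Qed.

Lemma contour_continuous a b gam : a < b -> piecewise_C1 a b gam ->
  ccontinuous_on a b gam.
Proof.
move: a b; apply: piecewise_C1_ind => [a b _ [c1 _] [c2 _] //|a u b au ub [c1 c2] [d1 d2]].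
by split; apply: (within_glue (ltW au) (ltW ub)).
Qed.

Lemma path_velocity_bounded_measurable a b gam : a < b -> piecewise_C1 a b gam ->
  cbounded_measurable a b (path_velocity gam).
Proof.
move: a b; apply: piecewise_C1_ind => [a b _ C1 C2|a u b au ub [c1 c2] [d1 d2]].
  have [g [g1 g2] Hg] := path_velocity_C1 C1 C2.
  by split; [apply: (bounded_measurable_eq_oo g1)|apply: (bounded_measurable_eq_oo g2)];
    move=> t /Hg[_ _ ->].
by split; apply: (bounded_measurable_glue (ltW au) (ltW ub)).
Qed.

(** Differentiation in the real parameter of a path, not complex differentiation. *)
Definition is_cderive (u : R -> R[i]) (t : R) (v : R[i]) :=
  is_derive t 1 (fun t => Re (u t)) (Re v) /\ is_derive t 1 (fun t => Im (u t)) (Im v).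

Lemma is_cderive_cst c t : is_cderive (fun=> c) t 0.
Proof. by split; exact: is_derive_cst. Qed.

Lemma is_cderiveD u1 u2 t v1 v2 : is_cderive u1 t v1 -> is_cderive u2 t v2 ->
  is_cderive (fun t => u1 t + u2 t) t (v1 + v2).
Proof.
move=> [D1 D2] [E1 E2]; split.
  by rewrite (funext (fun t => Re_add (u1 t) (u2 t))) Re_add; exact: is_deriveD.
by rewrite (funext (fun t => Im_add (u1 t) (u2 t))) Im_add; exact: is_deriveD.
Qed.

Lemma is_cderiveZ c u t v : is_cderive u t v ->
  is_cderive (fun t => c * u t) t (c * v).
Proof.
move=> [D1 D2]; split.
  rewrite (funext (fun t => Re_mul c (u t))) Re_mul.
  by apply: is_deriveB; exact: is_deriveZ.
rewrite (funext (fun t => Im_mul c (u t))) Im_mul.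
by apply: is_deriveD; exact: is_deriveZ.
Qed.

Lemma is_cderive_cexp u t v : is_cderive u t v ->
  is_cderive (fun t => cexp (u t)) t (cexp (u t) * v).
Proof.
move=> [D1 D2].
have De : is_derive t 1 (fun t => expR (Re (u t))) (expR (Re (u t)) * Re v).
  exact: (@is_derive1_comp _ expR (fun t => Re (u t))).
have Dc : is_derive t 1 (fun t => cos (Im (u t))) (- sin (Im (u t)) * Im v).
  exact: (@is_derive1_comp _ cos (fun t => Im (u t))).
have Ds : is_derive t 1 (fun t => sin (Im (u t))) (cos (Im (u t)) * Im v).
  exact: (@is_derive1_comp _ sin (fun t => Im (u t))).
split.
  rewrite Re_mul; apply: (@is_derive_eq _ _ _ _ _ _ _ _ (is_deriveM De Dc)).
  by rewrite /cexp /GRing.scale /=; ring.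
rewrite Im_mul; apply: (@is_derive_eq _ _ _ _ _ _ _ _ (is_deriveM De Ds)).
by rewrite /cexp /GRing.scale /=; ring.
Qed.

(** The chain rule along the path stands in for holomorphy of [F]. The real theorem is applied on
    each C1 piece and the boundary terms telescope. *)
Lemma contour_FTC gam (F f : R[i] -> R[i]) :
  (forall a b, ccontinuous_on a b gam -> ccontinuous_on a b (fun t => F (gam t))) ->
  (forall a b, ccontinuous_on a b gam -> ccontinuous_on a b (fun t => f (gam t))) ->
  (forall (t : R) v, is_cderive gam t v ->
     is_cderive (fun t => F (gam t)) t (f (gam t) * v)) ->
  forall a b, a < b -> piecewise_C1 a b gam ->
  contour_integral a b gam f = F (gam b) - F (gam a).
Proof.
move=> cF cf dF a b ab pw.
(* Continuity and bounded measurability are carried through the induction since splitting the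
   integral at a break point requires them. *)
suff [] : ccontinuous_on a b gam /\ cbounded_measurable a b (path_velocity gam) /\
  contour_integral a b gam f = F (gam b) - F (gam a) by move=> _ [].
move: a b ab pw; apply: piecewise_C1_ind => [a b ab C1 C2|a u b au ub].
  have cg : ccontinuous_on a b gam by split; [case: C1|case: C2].
  have [g gc Hg] := path_velocity_C1 C1 C2; split=> //; split.
    by case: gc => g1 g2; split;
      [apply: (bounded_measurable_eq_oo g1)|apply: (bounded_measurable_eq_oo g2)];
      move=> t /Hg[_ _ ->].
  have [k1 k2] := ccontinuous_onM (cf a b cg) gc.
  have [F1 F2] := cF a b cg.
  apply: complex_eqP; rewrite ?Re_add ?Im_add ?Re_opp ?Im_opp /=.
    apply: (FTC_eq_oo ab k1 _ F1) => t /Hg[D1 D2 E]; first by rewrite E.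
    by have [] := dF t _ (conj D1 D2).
  apply: (FTC_eq_oo ab k2 _ F2) => t /Hg[D1 D2 E]; first by rewrite E.
  by have [] := dF t _ (conj D1 D2).
move=> [c1 [v1 E1]] [c2 [v2 E2]].
have c : ccontinuous_on a b gam.
  by case: c1 => ? ?; case: c2 => ? ?; split; apply: (within_glue (ltW au) (ltW ub)).
have v : cbounded_measurable a b (path_velocity gam).
  case: v1 => ? ?; case: v2 => ? ?.
  by split; apply: (bounded_measurable_glue (ltW au) (ltW ub)).
split=> //; split=> //.
rewrite /contour_integral (cintegral_split (ltW au) (ltW ub)).
  by rewrite -!/(contour_integral _ _ gam f) E1 E2 addrC subrKA.
exact: cbounded_measurableM (ccontinuous_on_bounded_measurable (cf a b c)) v.
Qed.

Lemma contour_integral_cst a b gam c : closed_contour a b gam ->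
  contour_integral a b gam (fun=> c) = 0.
Proof.
move=> [ab gab pw]; rewrite (contour_FTC (F := fun z => c * z) _ _ _ ab pw).
- by rewrite gab subrr.
- by move=> a' b'; apply: ccontinuous_onM; exact: ccontinuous_on_cst.
- by move=> a' b' _; exact: ccontinuous_on_cst.
- by move=> t v; exact: is_cderiveZ.
Qed.

(** The primitive [c^-1 * cexp (c * z + d)] takes equal values at the two ends of a closed path. *)
Lemma contour_integral_cexp a b gam (c d : R[i]) : closed_contour a b gam -> c != 0 ->
  contour_integral a b gam (fun z => cexp (c * z + d)) = 0.
Proof.
move=> [ab gab pw] c0.
have cE a' b' : ccontinuous_on a' b' gam ->
    ccontinuous_on a' b' (fun t => cexp (c * gam t + d)).
  move=> cg; apply/ccontinuous_on_cexp/ccontinuous_onD/ccontinuous_on_cst.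
  exact: ccontinuous_onM (ccontinuous_on_cst _ _ c) cg.
rewrite (contour_FTC (F := fun z => c^-1 * cexp (c * z + d)) _ _ _ ab pw) //.
- by rewrite gab subrr.
- by move=> a' b' /cE; apply: ccontinuous_onM; exact: ccontinuous_on_cst.
- move=> t v D.
  have D' := is_cderiveD (is_cderiveZ c D) (is_cderive_cst d t).
  have := is_cderiveZ c^-1 (is_cderive_cexp D').
  by rewrite addr0 [c^-1 * (_ * _)]mulrCA mulKf.
Qed.

(* The integral of [cexp (s * (z - p) * L) / (z - p)] does not depend on
   [s] in [[0, 1]]: its increment over a step of length [h] is the integral of
   an entire function with a primitive, up to an error of order [h ^ 2]. *)
Lemma contour_integral_cexp_pole a b gam (L p : R[i]) : closed_contour a b gam ->
  avoids a b gam p ->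
  contour_integral a b gam (fun z => cexp ((z - p) * L) / (z - p)) =
  contour_integral a b gam (fun z => (z - p)^-1).
Proof.
move=> cg avp; have [ab gab pw] := cg.
have gamc := contour_continuous ab pw.
have velb := path_velocity_bounded_measurable ab pw.
set v := path_velocity gam in velb *.
pose w t := (gam t - p) * L.
have wc : ccontinuous_on a b w.
  apply: ccontinuous_onM; last exact: ccontinuous_on_cst.
  exact: ccontinuous_onD gamc (ccontinuous_on_cst _ _ _).
have ivc : ccontinuous_on a b (fun t => (gam t - p)^-1).
  apply: ccontinuous_onV; first by move=> t /avp; rewrite subr_eq0.
  exact: ccontinuous_onD gamc (ccontinuous_on_cst _ _ _).
have [W W0 HW] := norm1_bounded (ccontinuous_on_bounded_measurable wc).
have [K K0 HK] := norm1_bounded (ccontinuous_on_bounded_measurable ivc).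
have [V V0 HV] := norm1_bounded velb.
pose J (s : R) := cintegral a b (fun t => cexp (s%:C * w t) / (gam t - p) * v t).
have expc (s : R) : ccontinuous_on a b (fun t => cexp (s%:C * w t)).
  exact/ccontinuous_on_cexp/(ccontinuous_onM (ccontinuous_on_cst _ _ _)).
have Jb (s : R) : cbounded_measurable a b (fun t => cexp (s%:C * w t) / (gam t - p) * v t).
  apply: cbounded_measurableM => //.
  by apply/ccontinuous_on_bounded_measurable/ccontinuous_onM.
(* Product of the bounds for the factors of [err] below: the exponential, the remainder [q] with
   [h ^ 2] taken out, the inverse and the velocity. *)
pose D := 2 * expR W * (2 * W ^+ 2 * expR W) * K * V.
have step (s h : R) : 0 <= s <= 1 -> 0 <= h <= 1 ->
    norm1 (J (s + h) - J s) <= 2 * (D * h ^+ 2) * (b - a).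
  move=> /andP[s0 s1] /andP[h0 h1].
  pose q t := cexp (h%:C * w t) - 1 - h%:C * w t.
  pose err t := cexp (s%:C * w t) * q t / (gam t - p) * v t.
  have qc : ccontinuous_on a b q.
    apply: ccontinuous_onD.
      exact: ccontinuous_onD (expc h) (ccontinuous_on_cst _ _ _).
    apply: (ccontinuous_on_ext (h := fun t => - h%:C * w t)) => [t|].
      by rewrite mulNr.
    exact: ccontinuous_onM (ccontinuous_on_cst _ _ _) wc.
  have errb : cbounded_measurable a b err.
    apply: cbounded_measurableM => //.
    apply/ccontinuous_on_bounded_measurable/ccontinuous_onM => //.
    exact: ccontinuous_onM.
  have evb : cbounded_measurable a b (fun t => cexp (s%:C * w t) * v t).
    by apply: cbounded_measurableM => //; exact: ccontinuous_on_bounded_measurable.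
  (* The term of first order in [h]: the factor z - p of the exponent cancels the pole. The
     primitive of what is left divides by s L, so L = 0 and s = 0 are treated apart. *)
  have zero : h%:C * L * cintegral a b (fun t => cexp (s%:C * w t) * v t) = 0.
    have [->|L0] := eqVneq L 0; first by rewrite mulr0 mul0r.
    have [s_0|sn0] := eqVneq s 0.
      have := contour_integral_cst 1 cg; rewrite /contour_integral => E.
      rewrite (@cintegral_ext _ _ _ _ (fun t => 1 * v t)) ?E ?mulr0// => t _.
      by rewrite s_0 mul0r cexp0.
    have := @contour_integral_cexp a b gam (s%:C * L) (- s%:C * L * p) cg.
    rewrite /contour_integral => E.
    rewrite (@cintegral_ext _ _ _ _
       (fun t => cexp (s%:C * L * gam t + - s%:C * L * p) * v t)).
      rewrite E ?mulr0// mulf_neq0//.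
      by apply: contra sn0 => /eqP[->].
    move=> t _; congr (cexp _ * _); rewrite /w; ring.
  have -> : J (s + h) - J s = cintegral a b err.
    rewrite -[LHS]subr0 -zero; apply/eqP; rewrite !subr_eq -cintegralZ// -!cintegralD//.
      apply/eqP; apply: cintegral_ext => t tab.
      have gp : gam t - p != 0 by rewrite subr_eq0 avp.
      rewrite rmorphD/= mulrDl cexpD /err /q /w.
      move: (cexp _) (cexp _) => A B; field; exact: gp.
    by apply: cbounded_measurableD => //; apply: cbounded_measurableM => //;
      exact: cbounded_measurable_cst.
    by apply: cbounded_measurableM => //; exact: cbounded_measurable_cst.
  apply: norm1_cintegral => //; first exact: ltW.
  move=> t tab.
  have Hw (r : R) : 0 <= r <= 1 -> norm1 (r%:C * w t) <= r * W.
    move=> /andP[r0 r1]; apply: (le_trans (norm1M _ _)).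
    by rewrite norm1_real ger0_norm// ler_wpM2l// HW.
  have Hw1 (r : R) : 0 <= r <= 1 -> norm1 (r%:C * w t) <= W.
    by move=> r01; apply: (le_trans (Hw r r01)); rewrite ler_piMl//; case/andP: r01.
  have H1 : norm1 (cexp (s%:C * w t)) <= 2 * expR W.
    by rewrite (le_trans (norm1_cexp _))// ler_wpM2l// ler_expR Hw1// s0.
  have H2 : norm1 (q t) <= 2 * (h * W) ^+ 2 * expR W.
    rewrite (le_trans (cexpB1id_le _))//.
    rewrite ler_pM ?expR_ge0 ?mulr_ge0 ?sqr_ge0 ?norm1_ge0// ?ler_expR ?Hw1 ?h0//.
    by rewrite ler_wpM2l// ler_pXn2r ?nnegrE ?norm1_ge0 ?mulr_ge0// Hw// h0.
  have -> : D * h ^+ 2 = 2 * expR W * (2 * (h * W) ^+ 2 * expR W) * K * V.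
    by rewrite /D; ring.
  rewrite (le_trans (norm1M _ _))// ler_pM ?norm1_ge0 ?HV//.
  rewrite (le_trans (norm1M _ _))// ler_pM ?norm1_ge0 ?HK//.
  by rewrite (le_trans (norm1M _ _))// ler_pM ?norm1_ge0.
have J10 : J 1 = J 0.
  apply/eqP; rewrite -subr_eq0; apply/eqP/norm1_eq0.
  set d := norm1 _; set C := 2 * D * (b - a).
  (* Cut [0, 1] into n + 1 equal steps, each contributing at most C / (n + 1)^2. As n is arbitrary,
     the Archimedean property forces [d] to be 0. *)
  have dn n : d * n.+1%:R <= C.
    have n0 : n.+1%:R != 0 :> R by rewrite pnatr_eq0.
    have E : J 1 - J 0 = \sum_(k < n.+1)
        (J (k%:R / n.+1%:R + n.+1%:R^-1) - J (k%:R / n.+1%:R)).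
      have := telescope_sumr (fun k => J (k%:R / n.+1%:R)) (leq0n n.+1).
      rewrite divff// mul0r big_mkord => <-; apply: eq_bigr => k _.
      by rewrite -[k.+1%:R]natr1 mulrDl mul1r.
    have : d <= \sum_(k < n.+1) 2 * (D * n.+1%:R^-1 ^+ 2) * (b - a).
      rewrite /d E (le_trans (norm1_sum _))//; apply: ler_sum => k _; apply: step.
        by rewrite divr_ge0 ?ler0n//= ler_pdivrMr ?ltr0n// mul1r ler_nat ltnW.
      by rewrite invr_ge0 ler0n/= invf_le1 ?ler1n ?ltr0n.
    rewrite sumr_const card_ord -[X in _ <= X]mulr_natr => H.
    have -> : C = 2 * (D * n.+1%:R^-1 ^+ 2) * (b - a) * n.+1%:R * n.+1%:R.
      by rewrite /C; field.
    exact: ler_wpM2r.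
  apply/eqP; rewrite eq_le norm1_ge0 andbT leNgt; apply/negP => d0.
  have [m Hm] : exists m : nat, C / d < m%:R.
    exists (Num.bound `|C / d|).
    exact: le_lt_trans (ler_norm _) (archi_boundP (normr_ge0 _)).
  move: Hm; rewrite ltr_pdivrMr// => Hm; have := dn m.
  by rewrite leNgt => /negP; apply; rewrite (lt_trans Hm)// mulrC ltr_pM2l// ltr_nat.
transitivity (J 1).
  by apply: cintegral_ext => t _; rewrite /w mul1r.
by rewrite J10; apply: cintegral_ext => t _; rewrite mul0r cexp0 mul1r.
Qed.

End Contours.

(** * Residues *)

Section Residues.
Variables (R : realType) (a b : R) (gam : R -> R[i]).
Hypothesis cgam : closed_contour a b gam.

Lemma two_pi_i_neq0 : two_pi_i R != 0.
Proof.
apply/eqP => /(congr1 (@complex.Im R)) /= /eqP; rewrite mulf_eq0 pnatr_eq0 /=.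
by rewrite gt_eqF ?pi_gt0.
Qed.

Lemma contour_integral_cexp_div (L p : R[i]) : avoids a b gam p ->
  contour_integral a b gam (fun z => cexp (z * L) / (z - p)) =
  cexp (p * L) * (two_pi_i R * winding_number a b gam p).
Proof.
move=> avp; have [ab _ pw] := cgam.
rewrite /winding_number [two_pi_i R * _]mulrC divfK ?two_pi_i_neq0//.
rewrite -(contour_integral_cexp_pole L cgam avp) /contour_integral -cintegralZ.
  apply: cintegral_ext => t _; rewrite !mulrA -cexpD; congr (cexp _ / _ * _); ring.
apply: cbounded_measurableM; last exact: path_velocity_bounded_measurable.
have gp : ccontinuous_on a b (fun t => gam t - p).
  exact: ccontinuous_onD (contour_continuous ab pw) (ccontinuous_on_cst _ _ _).
apply/ccontinuous_on_bounded_measurable/ccontinuous_onM.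
  exact/ccontinuous_on_cexp/(ccontinuous_onM gp)/ccontinuous_on_cst.
by apply: ccontinuous_onV => // t /avp; rewrite subr_eq0.
Qed.

(** Partial fractions in the variable z^2 split the integrand into simple poles at the points m_j
    and -m_j; the latter have winding number 0. *)
Lemma contour_integral_symplectic n (m : 'I_n.+1 -> nat) (L : R[i]) :
  injective m -> (forall j, (0 < m j)%N) ->
  (forall j, encloses a b gam (m j)%:R) ->
  (forall j, excludes a b gam (- (m j)%:R)) ->
  contour_integral a b gam (fun z => (cexp (z * L) - cexp (- z * L))
    / \prod_(i < n.+1) ((z - (m i)%:R) * (z + (m i)%:R))) =
  two_pi_i R * \sum_j (cexp L ^+ m j - cexp L ^- m j) / (2 * (m j)%:R)
     * lagrange_weight (fun j => (m j)%:R ^+ 2) j.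
Proof.
move=> m_inj m_gt0 hin hout; have [ab _ pw] := cgam.
pose mu j : R[i] := (m j)%:R ^+ 2.
have mu_inj : injective mu.
  move=> i j /eqP; rewrite /mu eqrXn2 ?ler0n// eqr_nat => /eqP; exact: m_inj.
have m0 j : (m j)%:R != 0 :> R[i] by rewrite pnatr_eq0 -lt0n.
pose v := path_velocity gam.
pose G K p t := cexp (gam t * K) / (gam t - p) * v t.
have Gb K p : avoids a b gam p -> cbounded_measurable a b (G K p).
  move=> avp; apply: cbounded_measurableM; last exact: path_velocity_bounded_measurable.
  have gc := contour_continuous ab pw.
  apply/ccontinuous_on_bounded_measurable/ccontinuous_onM.
    exact/ccontinuous_on_cexp/(ccontinuous_onM gc)/ccontinuous_on_cst.
  apply: ccontinuous_onV => [t /avp|]; first by rewrite subr_eq0.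
  exact: ccontinuous_onD gc (ccontinuous_on_cst _ _ _).
have Gin K j : cintegral a b (G K (m j)%:R) = cexp ((m j)%:R * K) * two_pi_i R.
  have [av wn] := hin j; have := contour_integral_cexp_div K av.
  by rewrite wn mulr1.
have Gout K j : cintegral a b (G K (- (m j)%:R)) = 0.
  have [av wn] := hout j; have := contour_integral_cexp_div K av.
  by rewrite wn !mulr0.
pose c j := lagrange_weight mu j / (2 * (m j)%:R).
(* The expanded product of e^(zL) - e^(-zL), of 1/(z - m_j) - 1/(z + m_j) and of the velocity; [c j]
   collects the Lagrange weight and the 1/(2 m_j) from splitting 1/(z^2 - m_j^2). *)
pose H j t := G L (m j)%:R t + -1 * G (- L) (m j)%:R t
   + (-1 * G L (- (m j)%:R) t + G (- L) (- (m j)%:R) t).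
have Nb h : cbounded_measurable a b h -> cbounded_measurable a b (fun t => -1 * h t).
  by apply: cbounded_measurableM; exact: cbounded_measurable_cst.
have [bi bo] : (forall j K, cbounded_measurable a b (G K (m j)%:R)) /\
    (forall j K, cbounded_measurable a b (G K (- (m j)%:R))).
  by split=> j K; apply: Gb; [have [] := hin j | have [] := hout j].
have Hb j : cbounded_measurable a b (H j).
  by do 2?[apply: cbounded_measurableD]; try apply: Nb.
have HE j : cintegral a b (H j) = (cexp L ^+ m j - cexp L ^- m j) * two_pi_i R.
  have b1 := Nb _ (bi j (- L)); have b2 := Nb _ (bo j L).
  have b3 := cbounded_measurableD b2 (bo j (- L)).
  rewrite (cintegralD (cbounded_measurableD (bi j L) b1) b3).
  rewrite (cintegralD (bi j L) b1) (cintegralD b2 (bo j (- L))).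
  rewrite (cintegralZ _ (bi j (- L))) (cintegralZ _ (bo j L)) !Gin !Gout.
  by rewrite mulr0 !addr0 mulN1r -mulrBl mulrN cexpN cexpMn.
transitivity (cintegral a b (fun t => \sum_j c j * H j t)).
  apply: cintegral_ext => t tab.
  have zin j : gam t - (m j)%:R != 0 by have [av _] := hin j; rewrite subr_eq0 av.
  have zout j : gam t + (m j)%:R != 0.
    by have [av _] := hout j; rewrite -[(m j)%:R]opprK subr_eq0 av.
  have sq j : gam t ^+ 2 - mu j = (gam t - (m j)%:R) * (gam t + (m j)%:R).
    by rewrite subr_sqr.
  rewrite -(eq_bigr _ (fun j _ => sq j)) lagrange_partial_fractions//; last first.
    by move=> j; rewrite -subr_eq0 sq mulf_neq0.
  rewrite mulr_sumr mulr_suml; apply: eq_bigr => j _.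
  rewrite sq /c /H /G [gam t * - L]mulrN [- gam t * L]mulNr opprK -/v.
  move: (cexp _) (cexp _) (v t) (lagrange_weight _ _) => A B V W.
  by field; rewrite m0 zin zout.
rewrite cintegral_sum; last first.
  by move=> j; apply: cbounded_measurableM => //; exact: cbounded_measurable_cst.
rewrite mulr_sumr; apply: eq_bigr => j _; rewrite cintegralZ// HE /c /mu.
by move: (lagrange_weight _ j) (cexp L ^+ _ - _) => W X; field; rewrite m0.
Qed.

End Residues.

Theorem theorem3p18 (R : realType) (N : nat) (hN : (0 < N)%N)
    (lam : 'I_N -> nat)
    (hlam : forall i j : 'I_N, (i <= j)%N -> (lam j <= lam i)%N)
    (x : R[i]) (hx0 : x != 0) (hx1 : x != 1) (hxN1 : x != -1)
    (lnx : R[i]) (hlnx : cexp lnx = x)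
    (a b : R) (gam : R -> R[i]) (hgam : closed_contour a b gam)
    (hin : forall i : 'I_N, encloses a b gam (shifted lam i)%:R)
    (hout : forall i : 'I_N, excludes a b gam (- (shifted lam i)%:R)) :
  normalized_sympl_char lam x =
    2 * ((2 * N - 1)`!)%:R
      / ((x - x^-1) * (x + x^-1 - 2) ^+ (N - 1))
    * ((two_pi_i R)^-1
       * contour_integral a b gam (fun z : R[i] =>
           (cexp (z * lnx) - cexp (- z * lnx))
           / \prod_(i < N) ((z - (shifted lam i)%:R)
                            * (z + (shifted lam i)%:R)))).
Proof.
case: N hN lam hlam hin hout => // n _ lam hlam hin hout.
rewrite normalized_sympl_charE// contour_integral_symplectic//; last 2 first.
- exact: shifted_inj.
- exact: shifted_gt0.
rewrite mulKf ?two_pi_i_neq0// hlnx.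
have -> : (2 * n.+1 - 1 = n.*2.+1)%N by lia.
rewrite subn1 /=.
(* Both sides are now sums with the same weights; the leading 2 cancels the 2 in 1/(2 m_j). *)
rewrite -[2 * _ / _]mulrA -[RHS]mulrA mulrCA; congr (_ * _).
rewrite mulr_sumr; apply: eq_bigr => j _.
have m0 : (shifted lam j)%:R != 0 :> R[i] by rewrite pnatr_eq0 -lt0n shifted_gt0.
by move: (lagrange_weight _ j) (x ^+ _ - _) => W X; field; rewrite m0.
Qed.
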